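(* Let $k\ge 2$ and let $F=\bigcup_{i=1}^{k}P_{p_i}$ be the vertex-disjoint union of paths $P_{p_1},\dots,P_{p_k}$, where $p_i\ge 2$ for $1\le i\le k$. Then, for fixed $F$ and $n\to\infty$, $$ar(K_n,F)=\left(\sum_{i=1}^{k}\left\lfloor\frac{p_i}{2}\right\rfloor-\epsilon\right)n+O(1),$$ where $\epsilon=1$ if all $p_i$ are odd and $\epsilon=2$ otherwise.
   Context: $P_m$ denotes the path on $m$ vertices. A subgraph of an edge-colored graph is rainbow if all its edges receive distinct colors. For a graph $G$, $ar(K_n,G)$ is the maximum number of colors in an edge-coloring of $K_n$ containing no rainbow copy of $G$. The $O(1)$ term denotes a quantity bounded in absolute value by a constant depending only on $F$. *)

(* Defs.v *)
From mathcomp Require Import all_boot.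

Set Implicit Arguments.
Unset Strict Implicit.
Unset Printing Implicit Defensive.

Record sgraph := SGraph {
  svertex :> finType;
  adj : rel svertex;
  adj_sym : symmetric adj;
  adj_irrefl : irreflexive adj }.

Definition edges (G : sgraph) : {set {set G}} :=
  [set [set u.1; u.2] | u in [pred u : G * G | adj u.1 u.2]].

Section CompleteGraph.
Variable n : nat.

Definition complete_adj : rel 'I_n := fun x y => x != y.

Lemma complete_adj_sym : symmetric complete_adj.
Proof. by move=> x y; rewrite /complete_adj eq_sym. Qed.

Lemma complete_adj_irrefl : irreflexive complete_adj.
Proof. by move=> x; rewrite /complete_adj eqxx. Qed.

Definition complete_graph : sgraph :=
  SGraph complete_adj_sym complete_adj_irrefl.
End CompleteGraph.

Section PathGraph.
Variable m : nat.

Definition path_adj : rel 'I_m :=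
  fun x y => (x.+1 == y :> nat) || (y.+1 == x :> nat).

Lemma path_adj_sym : symmetric path_adj.
Proof. by move=> x y; rewrite /path_adj orbC. Qed.

Lemma path_adj_irrefl : irreflexive path_adj.
Proof. by move=> x; rewrite /path_adj orbb gtn_eqF. Qed.

Definition path_graph : sgraph := SGraph path_adj_sym path_adj_irrefl.
End PathGraph.

Section DisjointUnion.
Variables (I : finType) (G : I -> sgraph).

(* [tagged_as u v] is [v] transported to the component of [u]; it is only
   meaningful when both lie in the same component. *)
Definition union_adj : rel {i : I & G i} :=
  fun u v => (tag u == tag v) && adj (tagged u) (tagged_as u v).

Lemma tagged_asT i (x y : G i) :
  tagged_as (Tagged (fun i => G i) x) (Tagged (fun i => G i) y) = y.
Proof. exact: (tagged_asE (u := Tagged (fun i => G i) x)). Qed.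

Lemma union_adj_sym : symmetric union_adj.
Proof.
move=> u v; rewrite /union_adj eq_sym; case: eqP => //= eq_vu.
case: u v eq_vu => [i x] [j y] /= eq_ji; case: i / eq_ji x => x.
by rewrite !tagged_asT adj_sym.
Qed.

Lemma union_adj_irrefl : irreflexive union_adj.
Proof.
by move=> [i x]; rewrite /union_adj eqxx /= tagged_asT adj_irrefl.
Qed.

Definition disjoint_union : sgraph := SGraph union_adj_sym union_adj_irrefl.
End DisjointUnion.

(* Copies of [G] in [H] are represented by injective homomorphisms.
   An edge-coloring of [H] is a function on [{set H}], of which only the values
   on [edges H] matter. *)
Section Rainbow.
Variables (H G : sgraph) (T : finType) (c : {set H} -> T).

Definition num_colors : nat := #|[set c e | e in edges H]|.

Definition is_copy (f : {ffun G -> H}) : bool :=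
  injectiveb f && [forall x, forall y, adj x y ==> adj (f x) (f y)].

Definition is_rainbow (f : {ffun G -> H}) : bool :=
  dinjectiveb (fun e : {set G} => c (f @: e)) (mem (edges G)).

Definition has_rainbow_copy : bool :=
  [exists f : {ffun G -> H}, is_copy f && is_rainbow f].
End Rainbow.

(* The palette [{set H}] has more elements than [H] has edges, so restricting to
   it loses nothing; see [anti_ramsey_max]. If every coloring has a rainbow
   copy (e.g. [G] a single edge), the maximum is over the empty set and is 0. *)
Definition anti_ramsey (H G : sgraph) : nat :=
  \max_(c : {ffun {set H} -> {set H}} | ~~ has_rainbow_copy G c) num_colors c.

Lemma anti_ramsey_max (H G : sgraph) (T : finType) (c : {set H} -> T) :
  ~~ has_rainbow_copy G c -> num_colors c <= anti_ramsey H G.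
Proof.
move=> c_free.
pose r t := odflt set0 [pick e in edges H | c e == t].
have crK : {in edges H, forall e, c (r (c e)) = c e}.
  move=> e eH; rewrite /r; case: pickP => [e' /andP[_ /eqP] // | /(_ e)].
  by rewrite eH eqxx.
pose c' := [ffun e => r (c e)] : {ffun {set H} -> {set H}}.
have -> : num_colors c = num_colors c'.
  have c'E : c' =1 r \o c by move=> e; rewrite ffunE.
  rewrite /num_colors (eq_imset _ c'E) (imset_comp r c).
  rewrite [RHS]card_in_imset // => _ _ /imsetP[e eH ->] /imsetP[e' eH' ->] eq_r.
  by rewrite -(crK e eH) eq_r crK.
rewrite /anti_ramsey (bigmax_sup c') //.
apply: contra c_free => /existsP[f /andP[f_copy /dinjectiveP f_rb]].
apply/existsP; exists f; rewrite f_copy; apply/dinjectiveP => e e' eG eG' eq_c.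
by apply: f_rb => //; rewrite !ffunE eq_c.
Qed.

(* Main.v *)
Require Import Defs.
From mathcomp Require Import all_boot all_order all_algebra.
From mathcomp Require Import zify.

(** Write [n] for the number of vertices, [h_i] for [p_i / 2] and [G] for a graph
    with one edge of each colour.

    Lower bound: give distinct colours to the edges meeting a fixed set [A] of
    [sum h_i - eps] vertices and one further colour to all others. In a rainbow
    copy of [F] the preimage of [A] would cover all edges but at most one, which
    takes at least [sum h_i - (eps - 1)] vertices.

    Upper bound: an even path may be lengthened by one vertex, except that one of
    them, [P_(2h+2)], is kept if there is one. Suppose [G] does not contain [F].
    Removing a copy of [P_p] from [G] leaves a graph without the remaining
    paths, so that this copy is incident with more than [(h - 1/2) n] edges, and
    hence some [h] of its vertices form a set [B] with linearly many common
    neighbours. A path on [2h + 1] vertices can be found between [B] and its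
    common neighbours while avoiding any bounded set of vertices and colours, so
    [B] can be deleted and the other paths found by induction. For the last path
    [P_(2b+1)], a density argument gives a copy in [G] or many disjoint [P_(2b)];
    an edge joining the ends of two of these has a colour missing from one of
    them. Finally, the additional edge needed by [P_(2h+2)] joins two common
    neighbours of low degree or, if the other paths have used an edge outside
    [G], it comes from one of the remaining [P_(2b)]'s. *)

Set Implicit Arguments.
Unset Strict Implicit.
Unset Printing Implicit Defensive.

(** * Paths in graphs given as sets of edges *)

Section Paths.
Variable T : finType.
Implicit Types (G : {set {set T}}) (A B K U W X : {set T}) (s : seq T).

Definition is_graph G := forall e, e \in G -> #|e| = 2.
Definition gadj G : rel T := fun x y => [set x; y] \in G.
Definition pedges s : seq {set T} :=
  if s is x :: s' then pairmap (fun y z => [set y; z]) x s' else [::].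
Definition fedges (ss : seq (seq T)) := flatten (map pedges ss).
Definition avoid G X := [set e in G | [disjoint e & X]].
Definition meeting G X := [set e in G | ~~ [disjoint e & X]].

Lemma gadj_sym G : symmetric (gadj G).
Proof. by move=> x y; rewrite /gadj setUC. Qed.

Lemma gadj_neq G x y : is_graph G -> gadj G x y -> x != y.
Proof. by move=> gG /gG; rewrite cards2; case: (x == y). Qed.

Lemma edge_at G e x : is_graph G -> e \in G -> x \in e ->
  exists2 y, e = [set x; y] & y != x.
Proof.
move=> gG /gG/eqP/cards2P[a [b [nab ->]]]; rewrite !inE => /orP[]/eqP->.
  by exists b; rewrite // eq_sym.
by exists a; rewrite // setUC.
Qed.

Lemma sorted_pedges G s : sorted (gadj G) s = all (mem G) (pedges s).
Proof. by case: s => //= x s; elim: s x => //= y s IH x; rewrite IH. Qed.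

Lemma pedges_sub s e x : e \in pedges s -> x \in e -> x \in s.
Proof.
case: s => //= y s; elim: s y => //= z s IH y; rewrite inE => /orP[/eqP->|].
  by rewrite !inE => /orP[] ->; rewrite ?orbT.
by move=> /IH IHe /IHe xs; rewrite in_cons xs orbT.
Qed.

Lemma pedges_neq0 s e : e \in pedges s -> exists x, x \in e.
Proof.
case: s => //= y s; elim: s y => //= z s IH y; rewrite inE => /orP[/eqP->|/IH//].
by exists y; rewrite !inE eqxx.
Qed.

Lemma pedges_cover s x : 1 < size s -> x \in s -> exists2 e, e \in pedges s & x \in e.
Proof.
case: s => // y [|z s] // _; elim: s y z => [|w s IH] y z.
  by rewrite !inE => xs; exists [set y; z]; rewrite ?inE.
rewrite inE => /orP[/eqP->|/IH[e eP xe]]; last by exists e => //; rewrite inE eP orbT.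
by exists [set y; z]; rewrite ?inE eqxx.
Qed.

Lemma uniq_pedges s : uniq s -> uniq (pedges s).
Proof.
case: s => //= x s; elim: s x => //= y s IH x /andP[xys us].
rewrite IH // andbT; apply: contra xys => H.
by apply: (@pedges_sub (y :: s) _ x H); rewrite !inE eqxx.
Qed.

Lemma size_pedges s : size (pedges s) <= size s.
Proof. by case: s => //= x s; rewrite size_pairmap. Qed.

Lemma fedges_sub ss e x : e \in fedges ss -> x \in e -> x \in flatten ss.
Proof.
case/flattenP=> l /mapP[s sss ->] es xe; apply/flattenP; exists s => //.
exact: pedges_sub es xe.
Qed.

Lemma size_fedges ss : size (fedges ss) <= size (flatten ss).
Proof.
elim: ss => //= s ss IH; rewrite /fedges /= !size_cat; have := size_pedges s.
by move: IH; rewrite /fedges; lia.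
Qed.

Lemma uniq_fedges ss : uniq (flatten ss) -> uniq (fedges ss).
Proof.
elim: ss => //= s ss IH; rewrite /fedges /= !cat_uniq => /and3P[us /hasPn dis /IH uss].
rewrite uniq_pedges //= uss andbT; apply/hasPn => e eF; apply/negP => es.
have [x xe] := pedges_neq0 es.
by move: (dis x (fedges_sub eF xe)); rewrite /= (pedges_sub es xe).
Qed.

Definition forest G ps ss :=
  [/\ shape ss = ps, uniq (flatten ss) & {subset fedges ss <= G}].

Lemma forest_cover G ps ss : forest G ps ss -> all (leq 2) ps ->
  {subset flatten ss <= cover G}.
Proof.
move=> [<- _ sG] /allP ps2 x /flattenP[s sss xs].
have s2 : 1 < size s by apply: ps2; apply: map_f.
have [e es xe] := pedges_cover s2 xs.
apply/bigcupP; exists e => //; apply: sG; apply/flattenP; exists (pedges s) => //.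
exact: map_f.
Qed.

Lemma cover_avoid G X x : x \in cover (avoid G X) -> x \in cover G /\ x \notin X.
Proof.
case/bigcupP=> e; rewrite inE => /andP[eG /pred0P dis] xe; split.
  by apply/bigcupP; exists e.
by have /= := dis x; rewrite xe => /= ->.
Qed.

Lemma avoid_sub G X : {subset avoid G X <= G}.
Proof. by move=> e; rewrite inE => /andP[]. Qed.

Lemma avoid_graph G X : is_graph G -> is_graph (avoid G X).
Proof. by move=> gG e /avoid_sub /gG. Qed.

Lemma card_avoid G X : #|G| = #|avoid G X| + #|meeting G X|.
Proof.
rewrite -(cardsID (avoid G X) G); congr (_ + _); apply: eq_card => e; rewrite !inE.
  by case: (e \in G); rewrite // andbF.
by case: (e \in G); rewrite // ?andbF //= andbT.
Qed.

Lemma leq_card_bigcup (I : finType) (S : finType) (P : pred I) (F : I -> {set S}) :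
  #|\bigcup_(i | P i) F i| <= \sum_(i | P i) #|F i|.
Proof.
elim/big_rec2: _ => [|i m Y _ IH]; first by rewrite cards0.
by rewrite cardsU (leq_trans (leq_subr _ _)) // leq_add2l.
Qed.

Lemma card_meeting G X : is_graph G -> #|meeting G X| <= #|X| * #|T|.
Proof.
move=> gG; apply: (@leq_trans #|[set [set u.1; u.2] | u in setX X setT]|).
  apply: subset_leq_card; apply/subsetP => e; rewrite inE => /andP[eG].
  case/pred0Pn=> x /andP[xe xX]; have [y -> _] := edge_at gG eG xe.
  by apply/imsetP; exists (x, y); rewrite // !inE /= andbT; exact: xX.
by rewrite (leq_trans (leq_imset_card _ _)) // cardsX cardsT.
Qed.

(** The segment [y :: b] is traversed backwards: one chord leads into it at its end, the chord from
    [x] to [y] closes the cycle. *)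
Lemma cycle_splice (e : rel T) x y a b : symmetric e -> path e x (a ++ y :: b) ->
  e x y -> e (last x a) (last y b) -> cycle e ((x :: a) ++ rev (y :: b)).
Proof.
move=> es; rewrite cat_path /= => /and3P[pa _ pb] xy ll.
have rE : rev (y :: b) = last y b :: rev (belast y b) by rewrite lastI rev_rcons.
rewrite rcons_path cat_path last_cat pa rE /= ll /=.
rewrite rev_path (eq_path (e' := e)) ?pb //=.
by case: (b) => //= [|z b']; rewrite ?rev_cons ?last_rcons es.
Qed.

(* Splicing a path along a crossing pair of chords from its two ends gives a
   Hamilton cycle of its vertex set, which can be opened anywhere. *)
Lemma dirac_extend G K d s : is_graph G -> s != [::] -> uniq s -> {subset s <= K} ->
  sorted (gadj G) s -> (forall v, v \in K -> d <= #|[set u in K | gadj G v u]|) ->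
  [\/ d.*2 < size s,
      forall x y, x \in s -> y \in K -> gadj G x y -> y \in s |
      exists s', [/\ size s' = (size s).+1, uniq s', {subset s' <= K} &
        sorted (gadj G) s']].
Proof.
move=> gG; case: s => // x s _ us sK ps mind.
have [|small] := ltnP d.*2 (size (x :: s)); first by constructor 1.
have [/existsP[y /and3P[yK ys xy]]|/existsPn Nx] :=
    boolP [exists y, [&& y \in K, y \notin x :: s & gadj G x y]].
  constructor 3; exists (y :: x :: s); split=> //.
  - by rewrite cons_uniq ys.
  - by move=> z; rewrite in_cons => /orP[/eqP->|/sK].
  - by rewrite /= gadj_sym xy.
have [/existsP[y /and3P[yK ys xy]]|/existsPn Nl] :=
    boolP [exists y, [&& y \in K, y \notin x :: s & gadj G (last x s) y]].
  constructor 3; exists (rcons (x :: s) y); split=> //.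
  - by rewrite size_rcons.
  - by rewrite rcons_uniq ys.
  - by move=> z; rewrite mem_rcons in_cons => /orP[/eqP->|/sK].
  - by rewrite /= rcons_path xy andbT.
(* All neighbours of both ends in [K] now lie on the path. [I] and [J] each have at least [d]
   elements among [L] positions, and [L < d.*2], so they share a position, which gives the crossing
   chords. *)
pose L := size s; pose nt := nth x (x :: s).
pose I := [set i : 'I_L | gadj G x (nt i.+1)].
pose J := [set i : 'I_L | gadj G (nt i) (last x s)].
have dI : d <= #|I|.
  apply: leq_trans (mind x (sK x (mem_head _ _))) _.
  apply: leq_trans (leq_imset_card (fun i : 'I_L => nt i.+1) I).
  apply: subset_leq_card; apply/subsetP => u; rewrite inE => /andP[uK xu].
  have := Nx u; rewrite uK xu andbT /= negbK in_cons => /orP[/eqP ux|us'].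
    by move: (gadj_neq gG xu); rewrite ux eqxx.
  have iL : index u s < L by rewrite index_mem.
  by apply/imsetP; exists (Ordinal iL); rewrite ?inE /nt /= nth_index.
have dJ : d <= #|J|.
  apply: leq_trans (mind (last x s) (sK _ (mem_last _ _))) _.
  apply: leq_trans (leq_imset_card (fun i : 'I_L => nt i) J).
  apply: subset_leq_card; apply/subsetP => u; rewrite inE => /andP[uK xu].
  have := Nl u; rewrite uK xu andbT /= negbK => us'.
  have iL : index u (x :: s) < L.
    move: us'; rewrite -index_mem /= ltnS leq_eqVlt => /orP[/eqP E|//].
    have : nth x (x :: s) (index u (x :: s)) = u.
      by rewrite nth_index // -index_mem [X in X < _]/= E.
    rewrite [index _ _]E -[size s]/(size (x :: s)).-1 nth_last /= => lu.
    by move: (gadj_neq gG xu); rewrite lu eqxx.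
  apply/imsetP; exists (Ordinal iL); rewrite ?inE /nt [nat_of_ord _]/= nth_index //.
  by rewrite gadj_sym.
have /set0Pn[i] : I :&: J != set0.
  have mL : #|I :|: J| <= L by rewrite -[X in _ <= X]card_ord max_card.
  rewrite -card_gt0; have := cardsUI I J; move: mL dI dJ small.
  by rewrite /L /= -addnn; lia.
rewrite !inE => /andP[xi il].
pose a := take i s; pose y := nth x s i; pose b := drop i.+1 s.
have sE : s = a ++ y :: b by rewrite -drop_nth ?cat_take_drop.
have aE : last x a = nt i.
  rewrite (last_nth x) /a size_take ltn_ord.
  by rewrite -[x :: take i s]/(take i.+1 (x :: s)) nth_take.
have lE : last x s = last y b by rewrite sE last_cat.
set cy := (x :: a) ++ rev (y :: b).
have cyc : cycle (gadj G) cy.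
  apply: cycle_splice xi _; first exact: gadj_sym.
    by move: ps; rewrite /= {1}sE.
  by rewrite aE -lE.
have cys : perm_eq cy (x :: s).
  by rewrite [in X in perm_eq _ X]sE -cat_cons perm_cat2l perm_rev.
(* A vertex off the cycle with a neighbour on it gives a longer path, once the cycle is rotated to
   begin at that neighbour. *)
have [/existsP[u /existsP[w /and4P[ux wK uw nw]]]|/existsPn cl] :=
  boolP [exists u, exists y, [&& u \in x :: s, y \in K, gadj G u y & y \notin x :: s]].
  constructor 3; have : u \in cy by rewrite (perm_mem cys).
  case/rot_to=> j s' rE; exists (w :: u :: s'); rewrite -rE.
  have cm : rot j cy =i x :: s by move=> z; rewrite mem_rot (perm_mem cys).
  split; first by rewrite /= size_rot (perm_size cys).
  - by rewrite cons_uniq cm nw rot_uniq (perm_uniq cys).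
  - by move=> z; rewrite in_cons cm => /orP[/eqP->|/sK].
  - move: cyc; rewrite -(rot_cycle j) rE /= rcons_path => /andP[-> _].
    by rewrite gadj_sym uw.
constructor 2 => u w ux wK uw; have /existsPn/(_ w) := cl u.
by rewrite ux wK uw /= negbK.
Qed.

(** The path is extended until another outcome of [dirac_extend] occurs; it cannot outgrow [K]. *)
Lemma dirac G K d : is_graph G -> K != set0 ->
  (forall v, v \in K -> d <= #|[set u in K | gadj G v u]|) ->
  exists s, [/\ uniq s, {subset s <= K}, sorted (gadj G) s, s != [::] &
    d.*2 < size s \/ forall x y, x \in s -> y \in K -> gadj G x y -> y \in s].
Proof.
move=> gG /set0Pn[v vK] mind.
suff H m s : #|K| < m + size s -> s != [::] -> uniq s -> {subset s <= K} ->
    sorted (gadj G) s -> exists s, [/\ uniq s, {subset s <= K}, sorted (gadj G) s,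
      s != [::] & d.*2 < size s \/ forall x y, x \in s -> y \in K -> gadj G x y -> y \in s].
  apply: (H #|K| [:: v]) => //=; first by rewrite addn1.
  by move=> x; rewrite inE => /eqP->.
elim: m s => [|m IH] s lt s0 us sK ps.
  by move: lt; rewrite add0n ltnNge -(card_uniqP us) subset_leq_card //; apply/subsetP.
have [L|cl|[s' [sz us' sK' ps']]] := dirac_extend gG s0 us sK ps mind.
- by exists s; split=> //; left.
- by exists s; split=> //; right.
- by apply: (IH s') => //; [rewrite sz; lia | case: (s') sz].
Qed.

End Paths.

(** * Density *)

Section Core.
Variable T : finType.
Implicit Types (G : {set {set T}}) (A B K U W X : {set T}) (s : seq T).

(** For [K] disjoint from [A] these are the edges inside [K] or between [K] and [A]. The deletion
    argument shrinks [K] and keeps [A]. *)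
Definition edges_off G A K :=
  [set e in G | (e \subset K :|: A) && ~~ (e \subset A)].

Lemma edges_off_remove G A K X :
  #|edges_off G A K| <= #|edges_off G A (K :\: X)| + #|meeting (edges_off G A K) X|.
Proof.
rewrite (card_avoid _ X) leq_add2r; apply: subset_leq_card.
apply/subsetP => e; rewrite !inE => /andP[/and3P[-> /subsetP eKA ->] dis].
rewrite /= andbT; apply/subsetP => x xe; move: (eKA x xe); rewrite !inE.
by move/pred0P: dis => /(_ x) /=; rewrite xe /= => ->.
Qed.

(** As [X] is closed under adjacency within [K], an edge meeting [X] lies inside [X] or leads to
    [A]. *)
Lemma card_meeting_closed G A K X d : is_graph G ->
  (forall x, x \in X -> #|[set a in A | gadj G x a]| <= d) ->
  (forall x y, x \in X -> y \in K -> gadj G x y -> y \in X) ->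
  #|meeting (edges_off G A K) X| <= 'C(#|X|, 2) + #|X| * d.
Proof.
move=> gG dA cl.
apply: (@leq_trans #|[set e : {set T} | (e \subset X) && (#|e| == 2)] :|:
   \bigcup_(x in X) [set [set x; a] | a in [set a in A | gadj G x a]]|).
  apply: subset_leq_card; apply/subsetP => e; rewrite inE => /andP[].
  rewrite inE => /andP[eG /andP[/subsetP eKA _]] /pred0Pn[x /= /andP[xe xX]].
  have [y eE nyx] := edge_at gG eG xe.
  have xy : gadj G x y by rewrite /gadj -eE.
  rewrite in_setU; have : y \in e by rewrite eE !inE eqxx orbT.
  move=> /eKA; rewrite in_setU => /orP[yK|yA]; apply/orP; [left|right].
    rewrite inE (gG e eG) eqxx andbT eE; apply/subsetP => z.
    by rewrite !inE => /orP[]/eqP-> //; apply: cl xy.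
  by apply/bigcupP; exists x => //; rewrite eE; apply: imset_f; rewrite inE yA.
rewrite cardsU (leq_trans (leq_subr _ _)) // cards_draws leq_add2l.
apply: leq_trans (leq_card_bigcup _ _) _; rewrite -sum_nat_const.
by apply: leq_sum => x xX; apply: leq_trans (leq_imset_card _ _) (dA x xX).
Qed.

Lemma card_meeting_vertex G A K v : is_graph G ->
  #|meeting (edges_off G A K) [set v]| <= #|[set u in K | gadj G v u]| + #|A|.
Proof.
move=> gG.
apply: (@leq_trans #|[set [set v; u] | u in [set u in K | gadj G v u] :|: A]|).
  apply: subset_leq_card; apply/subsetP => e; rewrite inE => /andP[].
  rewrite inE => /andP[eG /andP[/subsetP eKA _]] /pred0Pn[x /= /andP[xe]].
  rewrite inE => /eqP xv; rewrite {x}xv in xe.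
  have [y eE nyx] := edge_at gG eG xe.
  have : y \in e by rewrite eE !inE eqxx orbT.
  move=> /eKA yKA; rewrite eE; apply: imset_f; move: yKA; rewrite !inE /gadj -eE eG.
  by rewrite andbT.
by rewrite (leq_trans (leq_imset_card _ _)) // cardsU leq_subr.
Qed.

(** The edge from [x] to [x'], with [x] joined to all of [A], is a candidate for the pendant edge in
    [ar_single]. *)
Definition special G A b s := [/\ size s = b.*2, sorted (gadj G) s &
  exists x x', [/\ x \in s, x' \in s, gadj G x x' & forall a, a \in A -> gadj G x a]].

Lemma double_bin2 m : 'C(m, 2).*2 = m * m.-1.
Proof. by rewrite bin2 halfK oddM; case: m => //= m; rewrite andNb subn0. Qed.

(* Erdos-Gallai style deletion: a vertex of degree less than [b] and a closed set
   that is not special both carry at most [#|A| + b.-1] edges per vertex, while a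
   special set carries an excess of at most [b]. *)
Lemma special_paths G A b K N : is_graph G -> 0 < b -> 
  (#|A| + b.-1) * #|K| + N * b < #|edges_off G A K| ->
  (exists s, [/\ size s = b.*2.+1, uniq s, {subset s <= K} & sorted (gadj G) s]) \/
  (exists ss, [/\ size ss = N, uniq (flatten ss) &
    forall s, s \in ss -> special G A b s /\ {subset s <= K}]).
Proof.
move=> gG b0; have [m] := ubnP #|K|; elim: m K N => // m IH K N; rewrite ltnS => Km lt.
case: N lt => [|N] lt; first by right; exists [::].
(* A vertex with fewer than [b] neighbours in [K] accounts for at most [#|A| + b.-1] edges, so
   deleting it preserves the inequality. *)
have [/existsP[v /andP[vK dv]]|/existsPn mind] :=
    boolP [exists v, (v \in K) && (#|[set u in K | gadj G v u]| < b)].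
  have cK : #|K| = (#|K :\: [set v]|).+1 by rewrite (cardsD1 v K) vK.
  have := edges_off_remove G A K [set v]; have := card_meeting_vertex A K v gG.
  move=> le1 le2; have := IH (K :\: [set v]) N.+1; case.
  - by rewrite -ltnS -cK.
  - by move: lt; rewrite cK mulnS; lia.
  - move=> [s [? ? sK ?]]; left; exists s; split=> // x /sK.
    by rewrite inE => /andP[].
  move=> [ss [? ? ssK]]; right; exists ss; split=> // s /ssK[? sK]; split=> // x /sK.
  by rewrite inE => /andP[].
have K0 : K != set0.
  apply: contraTneq lt => ->; rewrite -leqNgt.
  suff -> : edges_off G A set0 = set0 by rewrite cards0.
  by apply/setP => e; rewrite !inE set0U andbN andbF.
have md v : v \in K -> b <= #|[set u in K | gadj G v u]|.
  by move=> vK; have := mind v; rewrite vK /= -leqNgt.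
have [s [us sK ps s0 sL]] := dirac gG K0 md.
have [L|sb] := ltnP b.*2 (size s).
  left; exists (take b.*2.+1 s); split; first by rewrite size_take_min; lia.
  - exact: take_uniq.
  - by move=> x /mem_take /sK.
  - exact: take_sorted.
have {sL} cl : forall x y, x \in s -> y \in K -> gadj G x y -> y \in s.
  by case: sL => //; rewrite ltnNge sb.
pose X := [set x in s]; have cX : #|X| = size s by rewrite cardsE (card_uniqP us).
have XK : X \subset K by apply/subsetP => x; rewrite inE => /sK.
have cK : #|K| = #|K :\: X| + size s.
  by rewrite -cX cardsDS // subnK // subset_leq_card.
have clX x y : x \in X -> y \in K -> gadj G x y -> y \in X.
  by rewrite !inE; apply: cl.
have rem := edges_off_remove G A K X.
have b2 := double_bin2 (size s).
have spos : 0 < size s by case: (s) s0.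
have IHX N' : (#|A| + b.-1) * #|K :\: X| + N' * b < #|edges_off G A (K :\: X)| ->
  (exists s, [/\ size s = b.*2.+1, uniq s, {subset s <= K} & sorted (gadj G) s]) \/
  (exists ss, [/\ size ss = N', uniq (flatten ss) &
    forall s, s \in ss -> special G A b s /\ {subset s <= K :\: X}]).
  move=> lt'; have [|//|[s' [? ? sK' ?]]|] := IH (K :\: X) N'; first lia.
    by left; exists s'; split=> // x /sK'; rewrite inE => /andP[].
  by move=> [ss ?]; right; exists ss.
have weaken ss N' : [/\ size ss = N', uniq (flatten ss) &
    forall s, s \in ss -> special G A b s /\ {subset s <= K :\: X}] ->
    [/\ size ss = N', uniq (flatten ss) &
    forall s, s \in ss -> special G A b s /\ {subset s <= K}].
  move=> [? ? H]; split=> // t /H[? tK]; split=> // x /tK.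
  by rewrite inE => /andP[].
have degA x : x \in X -> #|[set a in A | gadj G x a]| <= #|A|.
  by move=> _; apply: subset_leq_card; apply/subsetP => a; rewrite inE => /andP[].
have me := card_meeting_closed gG degA clX; rewrite cX in me.
(* A set of fewer than [b.*2] vertices spans at most [b.-1] edges per vertex. *)
have [sb'|sb'] := ltnP (size s) b.*2.
  have [|?|[ss /weaken H]] := IHX N.+1; [|by left|by right; exists ss].
  have : (size s) * (size s).-1 <= (b.-1.*2) * size s.
    by rewrite mulnC leq_mul2r; apply/orP; right; lia.
  by move: lt; rewrite cK mulnDr mulnDl; move: me; nia.
(* On [b.*2] vertices the inner edges may exceed [b.-1] per vertex by [b] in total. If a vertex is
   joined to all of [A], the path is special and one of the [N] summands [b] pays for this;
   otherwise each vertex misses an element of [A], which saves [b.*2] edges. *)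
have sE : size s = b.*2 by apply/eqP; rewrite eqn_leq sb.
have [/existsP[x /andP[xs /forall_inP xA]]|/existsPn nsp] :=
    boolP [exists x, (x \in s) && [forall a in A, gadj G x a]].
  have [|?|[ss]] := IHX N; [|by left|].
    move: lt; rewrite cK mulnDr mulnDl mulSn; move: me rem b2; rewrite !sE; nia.
  move=> [ssN uss Hss]; right; exists (s :: ss); split; first by rewrite /= ssN.
    rewrite /= cat_uniq us uss andbT /=; apply/hasPn => y /flattenP[t /Hss[_ tK] /tK].
    by rewrite !inE => /andP[].
  move=> t; rewrite inE => /orP[/eqP->|/Hss[? tK]]; last first.
    by split=> // y /tK; rewrite inE => /andP[].
  split=> //; split=> //; have /card_gt0P[x'] := leq_trans b0 (md x (sK x xs)).
  rewrite inE => /andP[x'K xx']; exists x, x'; split=> //.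
  exact: cl xx'.
have degA' x : x \in X -> #|[set a in A | gadj G x a]| <= #|A|.-1.
  rewrite inE => xs; have := nsp x; rewrite xs /= => /forall_inPn[a aA nxa].
  rewrite (cardsD1 a A) aA /= subset_leq_card //; apply/subsetP => a'.
  by rewrite !inE => /andP[->]; rewrite andbT; apply: contraTneq => ->.
have A0 : 0 < #|A|.
  case: s s0 nsp {us sK ps cl sb X cX XK cK clX rem b2 spos IHX weaken degA me sb' sE degA'}.
    by [].
  move=> x s _ /(_ x); rewrite mem_head /= => /forall_inPn[a aA _].
  by apply/card_gt0P; exists a.
have me' := card_meeting_closed gG degA' clX; rewrite cX in me'.
have [|?|[ss /weaken H]] := IHX N.+1; [|by left|by right; exists ss].
move: lt; rewrite cK mulnDr mulnDl; move: me' rem b2; rewrite !sE.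
by case: #|A| A0 => // al _; case: b b0 {me md mind IH IHX weaken sb sb' sE} => // b _ /=; nia.
Qed.

Lemma edges_offT G : is_graph G -> edges_off G set0 setT = G.
Proof.
move=> gG; apply/setP => e; rewrite !inE setU0 subsetT /= subset0.
by case eG: (e \in G) => //=; rewrite -cards_eq0 (gG e eG).
Qed.

Lemma forest1 G s : uniq s -> sorted (gadj G) s -> forest G [:: size s] [:: s].
Proof.
move=> us ps; split=> //=; first by rewrite cats0.
by rewrite /fedges /= cats0; apply/allP; rewrite -sorted_pedges.
Qed.

(** One special path for empty [A] suffices; the other outcome is one vertex too long and gets
    truncated. *)
Lemma even_path G b : is_graph G -> 0 < b -> b.-1 * #|T| + b < #|G| ->
  exists s, [/\ size s = b.*2, uniq s & sorted (gadj G) s].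
Proof.
move=> gG b0 lt; have [|[s [sz us _ ps]]|] := @special_paths G set0 b setT 1 gG b0.
- by rewrite cards0 cardsT edges_offT // mul1n.
- exists (take b.*2 s); split; first by rewrite size_take_min; lia.
    exact: take_uniq.
  exact: take_sorted.
move=> [ss [sz us H]]; case: ss sz us H => [|s [|? ?]] // _ us H.
have [[? ? _] _] := H s (mem_head _ _).
by exists s; split=> //; move: us; rewrite /= cats0.
Qed.

(** With [A] empty, the number of disjoint paths on [b.*2] vertices asked for is too large for
    [#|T|]. Asking for that many costs about [#|T| / 2] edges, whence the threshold
    [(b - 1/2) * #|T|]. *)
Lemma odd_path G b : is_graph G -> 0 < b ->
  b.*2 * #|T| + b.*2 < #|G|.*2 + #|T| ->
  exists s, [/\ size s = b.*2.+1, uniq s & sorted (gadj G) s].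
Proof.
move=> gG b0 lt.
have [|[s [? ? _ ?]]|] := @special_paths G set0 b setT (#|T| %/ b.*2).+1 gG b0.
- rewrite cards0 cardsT edges_offT // mulSn.
  have := leq_trunc_div #|T| b.*2; rewrite -muln2 mulnA.
  by move: lt; case: b b0 => // b _; nia.
- by exists s.
move=> [ss [sz us H]].
have : size (flatten ss) = size ss * b.*2.
  elim: ss {sz us} H => //= s ss IH H; rewrite size_cat mulSn IH.
    by have [[-> _ _] _] := H s (mem_head _ _).
  by move=> t tss; apply: H; rewrite inE tss orbT.
have := max_card (mem (flatten ss)); rewrite (card_uniqP us) sz => le1 E.
have := ltn_ceil #|T| (_ : 0 < b.*2); rewrite double_gt0 => /(_ b0).
by rewrite ltnNge -E le1.
Qed.

End Core.

(** * Common neighbourhoods *)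

Lemma ex_subset (T : finType) (A : {set T}) k : k <= #|A| ->
  exists2 B : {set T}, B \subset A & #|B| = k.
Proof.
rewrite -bin_gt0 -(cards_draws A k) => /card_gt0P[B]; rewrite inE => /andP[BA /eqP Bk].
by exists B.
Qed.

Section CommonNeighbours.
Variable T : finType.
Implicit Types (G : {set {set T}}) (A B U W X : {set T}) (s : seq T).

(** A positive proportion of the vertices must have [h] neighbours in [W], and one of the at most
    [2 ^ #|W|] subsets of size [h] serves a fair share of them. *)
Lemma common_nbhd G W h : is_graph G ->
  h.*2 * #|T| + (2 ^ #|W|).*2 + #|W|.*2 < #|meeting G W|.*2 + #|T| ->
  exists B U, [/\ #|B| = h, [disjoint B & U],
    forall b u, b \in B -> u \in U -> gadj G u b &
    #|T| <= #|W|.+1.*2 * 2 ^ #|W| * #|U|].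
Proof.
move=> gG lt; pose N v := [set w in W | gadj G v w].
pose V := [set v in ~: W | h <= #|N v|].
pose U B := [set v in ~: W | B \subset N v].
have S1 : #|meeting G W| <= 2 ^ #|W| + \sum_(v in ~: W) #|N v|.
  apply: (@leq_trans #|powerset W :|: \bigcup_(v in ~: W) [set [set v; w] | w in N v]|).
    apply: subset_leq_card; apply/subsetP => e; rewrite inE => /andP[eG].
    rewrite in_setU inE; case eW: (e \subset W) => //=.
    have /subsetPn[v ve vW] := negbT eW.
    case/pred0Pn=> w /= /andP[we wW]; have [y eE nyv] := edge_at gG eG ve.
    apply/bigcupP; exists v; rewrite ?inE // eE; apply: imset_f; rewrite inE /gadj -eE eG.
    move: we; rewrite eE !inE andbT => /orP[]/eqP wE; last by rewrite -wE.
    by move: vW; rewrite -wE wW.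
  rewrite cardsU (leq_trans (leq_subr _ _)) // card_powerset leq_add2l.
  apply: leq_trans (leq_card_bigcup _ _) _.
  by apply: leq_sum => v _; apply: leq_imset_card.
(* A vertex outside [V] contributes at most [h], one of [V] at most [#|W|.+1]; taking successors
   avoids a truncated [h - 1]. *)
have S2 : \sum_(v in ~: W) #|N v|.+1 <= #|W|.+1 * #|V| + h * #|T|.
  rewrite (big_setID V) /= leq_add //.
    apply: leq_trans (_ : \sum_(v in V) #|W|.+1 <= _); last by rewrite sum_nat_const mulnC.
    rewrite (setIidPr _); last by apply/subsetP => v; rewrite inE => /andP[].
    apply: leq_sum => v _; rewrite ltnS subset_leq_card //.
    by apply/subsetP => w; rewrite inE => /andP[].
  apply: leq_trans (_ : \sum_(v in ~: W :\: V) h <= _).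
    by apply: leq_sum => v; rewrite !inE => /andP[]; case: (v \in W) => //=; rewrite -ltnNge.
  by rewrite sum_nat_const mulnC leq_mul2l max_card orbT.
have S3 : \sum_(v in ~: W) #|N v|.+1 = \sum_(v in ~: W) #|N v| + #|~: W|.
  by rewrite -sum1_card -big_split /=; apply: eq_bigr => v _; rewrite addn1.
have S4 : #|T| = #|W| + #|~: W| by rewrite cardsC.
have Vbig : #|T| < #|W|.+1.*2 * #|V|.
  move: S2; rewrite S3; move: lt S1; rewrite -!mul2n -mulnA -mulnA; lia.
have [/existsP[B /and3P[_ /eqP Bh big]]|/existsPn small] :=
  boolP [exists B : {set T}, [&& B \subset W, #|B| == h & #|T| <= #|W|.+1.*2 * 2 ^ #|W| * #|U B|]].
  exists B, (U B); split=> //.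
    rewrite disjoints_subset; apply/subsetP => b bB; rewrite !inE.
    apply/negP => /andP[bW /subsetP /(_ b bB)]; rewrite inE => /andP[].
    by rewrite (negPf bW).
  by move=> b u bB; rewrite inE => /andP[_ /subsetP /(_ b bB)]; rewrite inE => /andP[].
exfalso; move: Vbig; apply/negP; rewrite -leqNgt.
have S5 : #|V| <= \sum_(B in powerset W | #|(B : {set T})| == h) #|U B|.
  apply: leq_trans (leq_card_bigcup _ _); apply: subset_leq_card.
  apply/subsetP => v; rewrite inE => /andP[vW /ex_subset[B BN Bh]].
  apply/bigcupP; exists B; last by rewrite inE vW.
  rewrite inE Bh eqxx andbT; apply: subset_trans BN _.
  by apply/subsetP => w; rewrite inE => /andP[].
rewrite -(leq_pmul2r (expn_gt0 2 #|W|)) mulnAC.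
apply: leq_trans (leq_mul (leqnn _) S5) _; rewrite big_distrr /= [X in _ <= X]mulnC.
rewrite -card_powerset -sum_nat_const big_mkcondr /=; apply: leq_sum => B.
rewrite inE => BW; case: eqP => // Bh; have := small B; rewrite BW Bh eqxx /=.
by rewrite card_powerset -ltnNge => /ltnW.
Qed.

Fixpoint interleave s t : seq T :=
  if s is x :: s' then if t is y :: t' then x :: y :: interleave s' t' else [::] else [::].

Lemma perm_interleave s t : size s = size t -> perm_eq (interleave s t) (s ++ t).
Proof.
elim: s t => [|x s IH] [|y t] //= [st]; rewrite perm_cons perm_sym.
by rewrite -cat1s perm_catCA /= perm_cons perm_sym IH.
Qed.

Lemma pedges_interleave x s t e : e \in pedges (x :: interleave s t) ->
  exists u b, [/\ u \in x :: t, b \in s & e = [set u; b]].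
Proof.
elim: s t x => [|b s IH] [|u t] x //=; rewrite !inE => /or3P[/eqP->|/eqP->|/IH].
- by exists x, b; rewrite !mem_head.
- by exists u, b; rewrite setUC !inE !eqxx orbT.
move=> [v [b' [vt b's ->]]]; exists v, b'; split=> //.
  by rewrite in_cons vt orbT.
by rewrite in_cons b's orbT.
Qed.

Variables (col : eqType) (c : {set T} -> col).

(** Each colour lies on at most one edge of [G], so forbidding a bounded number of colours amounts
    to forbidding a bounded number of vertices. *)
Lemma card_colour_cover G (Z : seq col) : is_graph G -> {in G &, injective c} ->
  #|cover [set e in G | c e \in Z]| <= (size Z).*2.
Proof.
move=> gG cG; apply: leq_trans (leq_card_cover _) _.
set E := [set e in G | c e \in Z].
rewrite (eq_bigr (fun _ => 2)); last by move=> e; rewrite inE => /andP[/gG].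
rewrite sum_nat_const muln2 leq_double cardE -(size_map c).
apply: uniq_leq_size.
  rewrite map_inj_in_uniq ?enum_uniq // => e f; rewrite !mem_enum !inE.
  by move=> /andP[eG _] /andP[fG _]; apply: cG.
by move=> z /mapP[e]; rewrite mem_enum inE => /andP[_ ?] ->.
Qed.

(** From [y] the path alternates between [B], which it exhausts, and vertices of [U] outside [X] and
    off all edges of [G] with a colour in [Z]. As [y] may lie outside [U], its edges to [B] are
    treated by a separate hypothesis. *)
Lemma zigzag_from G B U X (Z : seq col) y : is_graph G -> {in G &, injective c} ->
  [disjoint B & U] -> (forall b u, b \in B -> u \in U -> gadj G u b) ->
  [disjoint X & B] -> y \notin B ->
  (forall b, b \in B -> gadj G y b /\ c [set y; b] \notin Z) ->
  #|B| + #|X| + (size Z).*2 < #|U| ->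
  exists s, [/\ size s = #|B|.*2, uniq (y :: s), {subset s <= B :|: U},
    [disjoint s & X] & forall e, e \in pedges (y :: s) -> e \in G /\ c e \notin Z].
Proof.
move=> gG cG dBU adj dXB yB By big.
pose R := y |: (X :|: cover [set e in G | c e \in Z]).
have /ex_subset[U' U'sub U'B] : #|B| <= #|U :\: R|.
  have := cardsD U R; have := subset_leq_card (subsetIr U R).
  have : #|R| <= 1 + #|X| + (size Z).*2.
    rewrite cardsU1 -addnA; apply: leq_add; first by case: (_ \notin _).
    by rewrite cardsU (leq_trans (leq_subr _ _)) // leq_add2l card_colour_cover.
  lia.
have U'P u : u \in U' -> [/\ u \in U, u != y, u \notin X &
    forall b, b \in B -> c [set u; b] \notin Z].
  move=> /(subsetP U'sub); rewrite in_setD 3!inE !negb_or -!andbA => /and4P[uy uX uc uU].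
  split=> // b bB; apply: contra uc => cZ; apply/bigcupP; exists [set u; b].
    by rewrite inE cZ andbT; apply: adj.
  by rewrite !inE eqxx.
have sz : size (enum B) = size (enum U') by rewrite -!cardE U'B.
have pi := perm_interleave sz.
exists (interleave (enum B) (enum U')).
have mi z : z \in interleave (enum B) (enum U') -> z \in B \/ z \in U'.
  by rewrite (perm_mem pi) mem_cat !mem_enum => /orP.
split.
- by rewrite (perm_size pi) size_cat -!cardE U'B addnn.
- rewrite cons_uniq (perm_uniq pi) cat_uniq !enum_uniq /= andbT; apply/andP; split.
    by apply/negP => /mi[|/U'P[_]]; [rewrite (negPf yB) | rewrite eqxx].
  apply/hasPn => u; rewrite /= !mem_enum => /U'P[uU _ _ _]; apply/negP => uB.
  by move/pred0P: dBU => /(_ u) /=; rewrite uB uU.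
- by move=> z /mi[zB|/U'P[zU _ _ _]]; rewrite inE ?zB // zU orbT.
- apply/pred0P => z /=; apply/negP => /andP[/mi[zB|/U'P[_ _ /negP//]] zX].
  by move/pred0P: dXB => /(_ z) /=; rewrite zB zX.
- move=> e /pedges_interleave[u [b [uU bB ->]]]; rewrite mem_enum in bB.
  move: uU; rewrite in_cons mem_enum => /orP[/eqP->|/U'P[uU _ _ uZ]]; first exact: By.
  by split; [apply: adj | apply: uZ].
Qed.

Lemma zigzag G B U X (Z : seq col) : is_graph G -> {in G &, injective c} ->
  [disjoint B & U] -> (forall b u, b \in B -> u \in U -> gadj G u b) ->
  [disjoint X & B] -> #|B| + #|X| + (size Z).*2 < #|U| ->
  exists s, [/\ size s = #|B|.*2.+1, uniq s, {subset s <= B :|: U},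
    [disjoint s & X] & forall e, e \in pedges s -> e \in G /\ c e \notin Z].
Proof.
move=> gG cG dBU adj dXB big; pose R := X :|: cover [set e in G | c e \in Z].
have /card_gt0P[y] : 0 < #|U :\: R|.
  have := cardsD U R; have := subset_leq_card (subsetIr U R).
  have : #|R| <= #|X| + (size Z).*2.
    by rewrite cardsU (leq_trans (leq_subr _ _)) // leq_add2l card_colour_cover.
  lia.
rewrite in_setD in_setU negb_or => /andP[/andP[yX yc] yU].
have yB : y \notin B.
  by apply/negP => yB; move/pred0P: dBU => /(_ y) /=; rewrite yU yB.
have [|s [sz us sBU sX sE]] := zigzag_from gG cG dBU adj dXB yB _ big.
  move=> b bB; have yb := adj b y bB yU; split=> //; apply: contra yc => cZ.
  by apply/bigcupP; exists [set y; b]; rewrite !inE ?eqxx // cZ andbT.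
exists (y :: s); split=> //=; first by rewrite sz.
  by move=> z; rewrite inE => /orP[/eqP->|/sBU //]; rewrite inE yU orbT.
rewrite disjoint_has /= negb_or -disjoint_has sX andbT.
exact: yX.
Qed.

End CommonNeighbours.

(** * Linear forests *)

Definition odds := map (fun h => h.*2.+1).

(** The threshold is [(s - 1/2) * #|T| + C / 2], doubled to stay within the naturals. *)
Definition turan_bound ps s C := forall (T : finType) (G : {set {set T}}),
  is_graph G -> s.*2 * #|T| + C < #|G|.*2 + #|T| -> exists ss, forest G ps ss.

Lemma odds_ge2 hs : all (leq 1) hs -> all (leq 2) (odds hs).
Proof. by rewrite all_map; apply: sub_all => h /=; rewrite !ltnS double_gt0. Qed.

(** A graph on fewer than [M] vertices has at most [2 ^ M] edges, so a large additive constant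
    replaces the assumption that [n] is large. *)
Lemma graph_large (T : finType) (G : {set {set T}}) M :
  (2 ^ M).*2 + M < #|G|.*2 + #|T| -> M <= #|T|.
Proof.
move=> big; rewrite leqNgt; apply/negP => lt.
have : #|G| <= 2 ^ M.
  apply: (@leq_trans (2 ^ #|T|)); last by rewrite leq_exp2l ?(ltnW lt).
  by rewrite -cardsT -card_powerset subset_leq_card //; apply/subsetP => e; rewrite inE subsetT.
by move: big; lia.
Qed.

Lemma forest_cons (T : finType) (G : {set {set T}}) ps s ss : uniq s ->
  [disjoint s & flatten ss] -> {subset pedges s <= G} -> forest G ps ss ->
  forest G (size s :: ps) (s :: ss).
Proof.
move=> us dis sG [sh uss ssG]; split; first by rewrite /= sh.
  by rewrite /= cat_uniq us uss andbT -disjoint_has disjoint_sym.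
by move=> e; rewrite /fedges /= mem_cat => /orP[/sG|/ssG].
Qed.

Lemma size_forest (T : finType) (ss : seq (seq T)) ps : shape ss = ps ->
  size (flatten ss) = sumn ps.
Proof. by move=> <-; rewrite size_flatten. Qed.

(* After deleting a copy of [P_p] the rest cannot contain the remaining paths, so
   the copy is incident with more than [(h - 1/2) n] edges. *)
Lemma hub_or_forest ps s C' h p : turan_bound ps s C' -> all (leq 2) ps -> 0 < s ->
  p <= h.*2.+2 -> exists C D, forall (T : finType) (G : {set {set T}}), is_graph G ->
  (h + s) * #|T| + C < #|G| + #|T| -> (exists ss, forest G (p :: ps) ss) \/
  exists B U : {set T}, [/\ #|B| = h, [disjoint B & U],
    forall b u, b \in B -> u \in U -> gadj G u b & #|T| <= D * #|U|].
Proof.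
move=> tb ps2 s0 ph; exists (h.+1 + C' + 2 ^ p + p), (p.+1.*2 * 2 ^ p) => T G gG lt.
(* As [s] is positive, [G] is dense enough for a path on [h.+1.*2] vertices, the first [p] of which
   are kept. *)
have [|t [sz ut pt]] := @even_path _ G h.+1 gG isT.
  by case: s s0 {tb} lt => // s _; rewrite addnS mulSn mulnDl /=; lia.
pose w := take p t; pose W := [set x in w].
have uw : uniq w by apply: take_uniq.
have sw : size w = p by rewrite size_take_min sz; lia.
have cW : #|W| = p by rewrite cardsE (card_uniqP uw).
have cG := card_avoid G W.
have [big|small] := ltnP (s.*2 * #|T| + C') (#|avoid G W|.*2 + #|T|).
  have [ss fss] := tb _ _ (avoid_graph (X := W) gG) big; left; exists (w :: ss).
  rewrite -sw; apply: forest_cons => //.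
  - apply/pred0P => x /=; apply/negP => /andP[xw xss].
    by have [_] := cover_avoid (forest_cover fss ps2 xss); rewrite inE xw.
  - have := take_sorted p pt; rewrite sorted_pedges => /allP wG e ew; exact: wG.
  - by case: fss => sh us sG; split=> // e /sG /avoid_sub.
right; have [|B [U H]] := @common_nbhd _ G W h gG; last first.
  by rewrite cW in H; exists B, U.
by rewrite cW; move: small lt; rewrite cG; lia.
Qed.

(** Induction on the number of paths: deleting the hub [B] costs at most [h * #|T|] edges, the other
    paths are found in the rest, and the path of [h] zigzags between [B] and [U] around them. *)
Lemma odd_turan hs : hs != [::] -> all (leq 1) hs ->
  exists C, turan_bound (odds hs) (sumn hs) C.
Proof.
elim: hs => // h hs IH _ /= /andP[h0 hs1].
have [->|hs0] := eqVneq hs [::].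
  exists h.*2 => T G gG; rewrite /= addn0 => lt.
  have [s [sz us ps]] := odd_path gG h0 lt; exists [:: s].
  by rewrite -sz; apply: forest1.
have [C' tb] := IH hs0 hs1.
have s0 : 0 < sumn hs by case: (hs) hs0 hs1 => //= a l _ /andP[a0 _]; rewrite ltn_addr.
have [|C0 [D0 ext]] := @hub_or_forest _ _ _ h h.*2.+1 tb (odds_ge2 hs1) s0; first by [].
(* From [N0 <= #|T| <= D0 * #|U|] it follows that [U] is as large as [zigzag] requires. *)
pose N0 := (D0 * (h + sumn (odds hs))).+1.
exists (C0.*2 + C' + (2 ^ N0).*2 + N0) => T G gG lt.
have n0 : N0 <= #|T| by apply: (@graph_large _ G); move: lt; lia.
have [|//|[B [U [Bh dBU adj nU]]]] := ext T G gG.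
  by move: lt; lia.
have cG := card_avoid G B; have := card_meeting B gG; rewrite Bh => cB.
have [|ss fss] := tb _ _ (avoid_graph (X := B) gG).
  by move: lt; rewrite cG; lia.
have [sh uss ssG] := fss; pose X := [set x in flatten ss].
have cX : #|X| = sumn (odds hs) by rewrite cardsE (card_uniqP uss) (size_forest sh).
have [|||s [sz us sBU sX sE]] := @zigzag _ _ id G B U X [::] gG _ dBU adj.
- by move=> e f _ _.
- apply/pred0P => x /=; apply/negP => /andP[]; rewrite inE.
  by move=> /(forest_cover fss (odds_ge2 hs1)) /cover_avoid[_ /negP].
- rewrite Bh cX addn0 ltnNge; apply/negP => le; have := leq_trans n0 nU.
  by rewrite ltnNge leq_mul2l le orbT.
exists (s :: ss); rewrite -Bh -sz; apply: forest_cons => //.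
- by apply: disjointWr sX; apply/subsetP => x; rewrite inE.
- by move=> e /sE[].
- by split=> // e /ssG /avoid_sub.
Qed.

(** * Rainbow forests with a pendant edge *)

Section Pendant.
Variables (T : finType) (col : eqType) (c : {set T} -> col).
Implicit Types (G : {set {set T}}) (A B U : {set T}) (ss : seq (seq T)).

Definition rainbow ps ss :=
  [/\ shape ss = ps, uniq (flatten ss) & uniq (map c (fedges ss))].

(** Unlike in [forest], the paths may use an edge outside [G]. The edge from [x'] to [x] is kept as
    the start of an even path continuing from [x] into the hub [A]. Lying in [cover G] keeps the
    paths away from vertices deleted before. *)
Definition pendant G A ps ss x x' :=
  [/\ rainbow ps ss /\ {subset flatten ss <= cover G}, [disjoint flatten ss & A],
    [/\ x \notin A, x' \notin A, x \notin flatten ss & x' \notin flatten ss],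
    gadj G x x' /\ c [set x; x'] \notin map c (fedges ss) &
    forall a, a \in A -> gadj G x a /\ c [set x; a] \notin map c (fedges ss)].

Lemma forest_rainbow G ps ss : {in G &, injective c} -> forest G ps ss -> rainbow ps ss.
Proof.
move=> cG [sh us sG]; split=> //; rewrite map_inj_in_uniq; first exact: uniq_fedges.
by move=> e f /sG eG /sG fG; apply: cG.
Qed.

Lemma rainbow_cons ps s ss : rainbow ps ss -> uniq s -> [disjoint s & flatten ss] ->
  uniq (map c (pedges s)) ->
  (forall e, e \in pedges s -> c e \notin map c (fedges ss)) ->
  rainbow (size s :: ps) (s :: ss).
Proof.
move=> [sh us uc] us' dis ucs H; split; first by rewrite /= sh.
  by rewrite /= cat_uniq us' us andbT -disjoint_has disjoint_sym.
rewrite /fedges /= map_cat cat_uniq ucs uc andbT /=; apply/hasPn => z zc.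
by apply/negP => /mapP[e /H /negP eN zE]; apply: eN; rewrite -zE.
Qed.

Lemma cover_edge G x y : gadj G x y -> x \in cover G.
Proof. by move=> xy; apply/bigcupP; exists [set x; y]; rewrite // !inE eqxx. Qed.

(* [w] is the colour of the only edge outside [G]. *)
Lemma pendant_cons G A v s x x' : is_graph G -> {in G &, injective c} ->
  1 < size s -> sorted (gadj G) s -> uniq (v :: s) -> [disjoint v :: s & A] ->
  v \in cover G -> x \notin A -> x' \notin A -> x \notin v :: s -> x' \notin v :: s ->
  gadj G x x' -> (forall a, a \in A -> gadj G x a) ->
  let w := c [set v; head v s] in w \notin map c (pedges s) ->
  w != c [set x; x'] -> (forall a, a \in A -> w != c [set x; a]) ->
  pendant G A [:: (size s).+1] [:: v :: s] x x'.
Proof.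
move=> gG cG s1 ps us dis vG xA x'A xs x's xx' xa w ws wx wa.
move: (ps); rewrite sorted_pedges => /allP sG.
have pE : pedges (v :: s) = [set v; head v s] :: pedges s by case: (s) s1.
have ucs : uniq (map c (pedges s)).
  have /= /andP[_ us'] := us.
  rewrite map_inj_in_uniq ?uniq_pedges // => e f /sG eG /sG fG; exact: cG.
have new y : gadj G x y -> c [set x; y] \notin map c (pedges s).
  move=> xy; apply/negP => /mapP[e es cE]; move: xs; rewrite inE negb_or => /andP[_] /negP[].
  by rewrite (@pedges_sub _ s e) // -(cG _ _ xy (sG e es) cE) !inE eqxx.
split.
- split; first split=> //; rewrite /fedges /= ?cats0 //.
    by rewrite -/(pedges (v :: s)) pE /= ws.
  move=> y; rewrite inE => /orP[/eqP->//|ys].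
  by have [e es ye] := pedges_cover s1 ys; apply/bigcupP; exists e => //; apply: sG.
- by rewrite /= cats0.
- by rewrite /= cats0.
- split=> //; rewrite /fedges /= cats0 -/(pedges (v :: s)) pE /= inE negb_or eq_sym wx.
  exact: new.
move=> a aA; have xaa := xa a aA; split=> //.
rewrite /fedges /= cats0 -/(pedges (v :: s)) pE /= inE negb_or eq_sym wa //.
exact: new.
Qed.

(** The new path runs from [y'] to [y] and then zigzags between [B] and [U]. Its first edge may lie
    outside [G], where [c] need not be injective, so its colour is forbidden to the zigzag
    explicitly. *)
Lemma attach G B U ps ss y y' : is_graph G -> {in G &, injective c} ->
  [disjoint B & U] -> (forall b u, b \in B -> u \in U -> gadj G u b) ->
  rainbow ps ss -> [disjoint flatten ss & B] ->
  y \notin B -> y' \notin B -> y' != y -> y \notin flatten ss -> y' \notin flatten ss ->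
  c [set y'; y] \notin map c (fedges ss) ->
  (forall b, b \in B -> gadj G y b /\
     c [set y; b] \notin c [set y'; y] :: map c (fedges ss)) ->
  #|B| + (sumn ps).+1 + (sumn ps).+1.*2 < #|U| ->
  exists s, rainbow (#|B|.*2.+2 :: ps) (s :: ss).
Proof.
move=> gG cG dBU adj rss dss yB y'B yy' yss y'ss cy By big.
have [sh us _] := rss.
pose X := [set x in y' :: flatten ss]; pose Z := c [set y'; y] :: map c (fedges ss).
have szX : #|X| <= (sumn ps).+1.
  by rewrite cardsE (leq_trans (card_size _)) //= (size_forest sh).
have szZ : size Z <= (sumn ps).+1.
  by rewrite /= size_map ltnS -(size_forest sh) size_fedges.
have [||s [sz uys sBU sX sE]] := @zigzag_from _ _ c G B U X Z y gG cG dBU adj _ yB By.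
- apply/pred0P => x /=; apply/negP; rewrite !inE => /andP[/orP[/eqP->|xss] xB].
    by rewrite xB in y'B.
  by move/pred0P: dss => /(_ x) /=; rewrite xss xB.
- by move: big szX szZ; lia.
have y's : y' \notin y :: s.
  rewrite inE negb_or yy' /=; apply/negP => y's.
  by move/pred0P: sX => /(_ y') /=; rewrite y's !inE eqxx.
exists (y' :: y :: s); rewrite -sz -[_.+2]/(size (y' :: y :: s)).
apply: rainbow_cons => //.
- by rewrite cons_uniq y's.
- apply/pred0P => x /=; apply/negP; rewrite !inE => /andP[/or3P[/eqP->|/eqP->|xs] xss].
  + by rewrite xss in y'ss.
  + by rewrite xss in yss.
  by move/pred0P: sX => /(_ x) /=; rewrite xs !inE xss orbT.
- rewrite -[pedges _]/([set y'; y] :: pedges (y :: s)) map_cons cons_uniq; apply/andP; split.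
    by apply/mapP => -[e /sE[_]]; rewrite inE negb_or => /andP[/negP eN _] E; apply: eN; rewrite E.
  rewrite map_inj_in_uniq ?uniq_pedges // => e f /sE[eG _] /sE[fG _]; exact: cG.
- move=> e; rewrite -[pedges _]/([set y'; y] :: pedges (y :: s)) in_cons => /orP[/eqP->//|/sE[_]].
  by rewrite inE negb_or => /andP[].
Qed.

End Pendant.

(** For [k = 0] this is the case of odd paths only; for [k = h] the set [A] will be the hub of a
    path on [h.*2.+2] vertices. The threshold is [(k + sumn hs - 1) * #|T| + C], written without
    subtraction. *)
Definition ar_bound hs k C := forall (T : finType) (col : eqType)
    (c : {set T} -> col) (G : {set {set T}}) (A : {set T}),
  is_graph G -> {in G &, injective c} -> #|A| = k ->
  (k + sumn hs) * #|T| + C < #|G| + #|T| ->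
  (exists2 ss, forest G (odds hs) ss & [disjoint flatten ss & A]) \/
  exists ss x x', pendant c G A (odds hs) ss x x'.

Lemma card_edges_off (T : finType) (G : {set {set T}}) (A : {set T}) :
  #|G| <= #|edges_off G A (~: A)| + 2 ^ #|A|.
Proof.
rewrite -card_powerset -[X in X <= _](cardsID (powerset A)) addnC leq_add //.
  apply: subset_leq_card; apply/subsetP => e; rewrite !inE => /andP[eA ->].
  by rewrite setUC setUCr subsetT eA.
by apply: subset_leq_card; apply: subsetIr.
Qed.

(* Two special paths are joined by an edge between their heads, whose colour
   occurs on at most one of them, and two more special paths are kept so that
   this colour misses the pendant edges of one of them. *)
Lemma ar_single b k : 0 < b -> exists C, ar_bound [:: b] k C.
Proof.
move=> b0; exists (2 ^ k + 4 * b) => T col c G A gG cG kA; rewrite /= addn0 => lt.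
have off := card_edges_off G A.
have [|[s [sz us sA ps]]|[ss [sz uss H]]] := @special_paths _ G A b (~: A) 4 gG b0.
- have le : #|~: A| <= #|T| by apply: max_card.
  have := leq_mul (leqnn (k + b.-1)) le; move: lt off; rewrite kA.
  by case: (b) b0 => // b' _; rewrite addnS mulSn /=; lia.
- left; exists [:: s]; first by rewrite /odds /= -sz; apply: forest1.
  rewrite /= cats0; apply/pred0P => x /=; apply/negP => /andP[/sA].
  by rewrite inE => /negP.
right; case: ss sz uss H => [|s1 [|s2 [|s3 [|s4 []]]]] // _.
rewrite /= cats0 => uss H.
have [[z1 p1 _] A1] : special G A b s1 /\ {subset s1 <= ~: A} by apply: H; rewrite !inE eqxx.
have [[z2 p2 _] A2] : special G A b s2 /\ {subset s2 <= ~: A} by apply: H; rewrite !inE eqxx ?orbT.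
have [[z3 p3 [x3 [y3 [x3s y3s e3 a3]]]] A3] : special G A b s3 /\ {subset s3 <= ~: A}.
  by apply: H; rewrite !inE eqxx ?orbT.
have [[z4 p4 [x4 [y4 [x4s y4s e4 a4]]]] A4] : special G A b s4 /\ {subset s4 <= ~: A}.
  by apply: H; rewrite !inE eqxx ?orbT.
move: uss; rewrite catA cat_uniq => /and3P[u12 /hasPn d1234].
rewrite cat_uniq => /and3P[u3 /hasPn d34 u4].
have bb : 1 < b.*2 by case: (b) b0.
case: s1 z1 p1 A1 u12 d1234 {H} => [|u1 s1] z1 p1 A1 u12 d1234; first by move: z1 bb => /= <-.
case: s2 z2 p2 A2 u12 d1234 => [|u2 s2] z2 p2 A2 u12 d1234; first by move: z2 bb => /= <-.
pose w := c [set u1; u2].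
have [x [x' [xs xs' xx' xa [wx wa]]]] : exists x x', [/\ x \in s3 ++ s4, x' \in s3 ++ s4,
    gadj G x x', forall a, a \in A -> gadj G x a &
    w != c [set x; x'] /\ forall a, a \in A -> w != c [set x; a]].
  pose bad (x : T) (s : seq T) :=
    [exists y : T, [&& (y \in s) || (y \in A), gadj G x y & c [set x; y] == w]].
  have good x y s : y \in s -> gadj G x y -> (forall a, a \in A -> gadj G x a) ->
      ~~ bad x s -> w != c [set x; y] /\ forall a, a \in A -> w != c [set x; a].
    move=> ys xy xA /existsPn nb; split=> [|a aA]; rewrite eq_sym.
      by have := nb y; rewrite ys xy.
    by have := nb a; rewrite aA orbT xA.
  (* If [x3] and [x4] were both bad, their edges of colour [w] would coincide, placing [x4] in [s3]
     or in [A]. *)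
  have [/existsP[y /and3P[yP xy /eqP cy]]|/(good _ _ _ y3s e3 a3)?] :=
    boolP (bad x3 s3); last first.
    by exists x3, y3; split; rewrite ?mem_cat ?x3s ?y3s.
  exists x4, y4; split; rewrite ?mem_cat ?x4s ?y4s ?orbT //.
  apply: good y4s e4 a4 _; apply/existsPn => z; apply/negP => /and3P[zP xz /eqP cz].
  have E : [set x4; z] = [set x3; y] by apply: cG; rewrite // cy cz.
  have : x4 \in [set x3; y] by rewrite -E !inE eqxx.
  rewrite !inE => /orP[/eqP xx|/eqP xy4].
    by have := d34 x4 x4s; rewrite /= xx x3s.
  move: yP; rewrite -xy4 (negPf (d34 x4 x4s)) /=.
  by have := A4 x4 x4s; rewrite inE => /negPf->.
have off34 z : z \in s3 ++ s4 -> z \notin A /\ z \notin (u1 :: s1) ++ (u2 :: s2).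
  move=> zs; split; last exact: d1234.
  by move: zs; rewrite mem_cat => /orP[/A3|/A4]; rewrite inE.
have [xA x12] := off34 _ xs; have [x'A x'12] := off34 _ xs'.
have disA s : {subset s <= (u1 :: s1) ++ (u2 :: s2)} -> [disjoint s & A].
  move=> sub; apply/pred0P => z /=; apply/negP => /andP[/sub].
  by rewrite mem_cat => /orP[/A1|/A2]; rewrite inE => /negPf->.
have hd u s : size (u :: s) = b.*2 -> sorted (gadj G) (u :: s) -> u \in cover G.
  by case: s => [|v s] /= sz; [move: bb; rewrite -sz | move=> /andP[/cover_edge]].
suff fin v s : size s = b.*2 -> sorted (gadj G) s -> uniq (v :: s) -> v \in cover G ->
    {subset v :: s <= (u1 :: s1) ++ (u2 :: s2)} -> [set v; head v s] = [set u1; u2] ->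
    w \notin map c (pedges s) ->
    pendant c G A (odds [:: b]) [:: v :: s] x x'.
  have u12' := u12; rewrite cat_uniq in u12'; have /and3P[us1 /hasPn d12 us2] := u12'.
  have [wS|wS] := boolP (w \in map c (pedges (u1 :: s1))); last first.
    exists [:: u2 :: u1 :: s1], x, x'; apply: fin => //.
    - by rewrite cons_uniq us1 andbT (d12 u2 (mem_head _ _)).
    - exact: hd z2 p2.
    - move=> z; rewrite in_cons mem_cat => /orP[/eqP->|->] //.
      by rewrite mem_head orbT.
    - by rewrite setUC.
  exists [:: u1 :: u2 :: s2], x, x'; apply: fin => //.
  - rewrite cons_uniq us2 andbT; apply/negP => /d12.
    by rewrite /= mem_head.
  - exact: hd z1 p1.
  - move=> z; rewrite in_cons mem_cat => /orP[/eqP->|->]; last by rewrite orbT.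
    by rewrite mem_head.
  have [e es wE] := mapP wS; apply/negP => /mapP[f fs wF].
  have := p1; rewrite sorted_pedges => /allP/(_ e es) eG.
  have := p2; rewrite sorted_pedges => /allP/(_ f fs) fG.
  have ef : e = f by apply: cG => //; rewrite -wE wF.
  have [z ze] := pedges_neq0 es; have zs1 := pedges_sub es ze.
  by rewrite ef in ze; have := d12 z (pedges_sub fs ze); rewrite /= zs1.
move=> sz ps us vG sub vE ws; rewrite /odds /= -sz.
apply: pendant_cons => //; rewrite ?sz ?vE //.
- exact: disA.
- by apply: contra x12 => /sub.
- by apply: contra x'12 => /sub.
Qed.

(** The induction of [odd_turan], started from [ar_single]. Each new zigzag path must also avoid the
    pendant edge, its colour, the colours from [x] to [A], and those of the paths found before. *)
Lemma ar_odds hs k : hs != [::] -> all (leq 1) hs -> exists C, ar_bound hs k C.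
Proof.
elim: hs => // h hs IH _ /= /andP[h0 hs1].
have [->|hs0] := eqVneq hs [::]; first exact: ar_single.
have [C' ih] := IH hs0 hs1.
have [Ct tb] := odd_turan hs0 hs1.
have s0 : 0 < sumn hs by case: (hs) hs0 hs1 => //= a l _ /andP[a0 _]; rewrite ltn_addr.
have [|C0 [D0 ext]] := @hub_or_forest _ _ _ h h.*2.+1 tb (odds_ge2 hs1) s0; first by [].
pose M := sumn (odds hs).
pose N0 := (D0 * (h + M.+2 + (M + k).+1.*2)).+1.
exists (C0 + C' + (2 ^ N0).*2 + N0) => T col c G A gG cG kA lt.
have n0 : N0 <= #|T| by apply: (@graph_large _ G); move: lt; lia.
(* The hub is sought in [G1], so that the new path misses [A]; the other paths are sought in
   [avoid G B], which retains the edges between [A] and vertices outside [B]. *)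
pose G1 := avoid G A; have gG1 : is_graph G1 := avoid_graph (X := A) gG.
have sub1 : {subset G1 <= G} := @avoid_sub _ G A.
have cG1 : {in G1 &, injective c} by apply: sub_in2 cG.
have offA x y : gadj G1 x y -> x \notin A.
  by move=> /cover_edge/cover_avoid[].
have cA := card_avoid G A; have := card_meeting A gG; rewrite kA => mA.
have {}lt : (k + (h + sumn hs)) * #|T| + (C0 + C') < #|G| + #|T|.
  by move: lt => /=; lia.
have odds2 := odds_ge2 hs1.
have [|[ss fss]|[B [U [Bh dBU adj nU]]]] := ext T G1 gG1.
- by move: lt mA; rewrite cA -/G1 !mulnDl; lia.
- left; exists ss.
    by case: fss => sh us sG; split=> // e /sG /sub1.
  apply/pred0P => x /=; apply/negP => /andP[xs xA].
  have [|_ /negP//] := cover_avoid (forest_cover fss _ xs).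
  by rewrite /= odds2 andbT ltnS double_gt0.
have Ubig : h + M.+2 + (M + k).+1.*2 < #|U|.
  rewrite ltnNge; apply/negP => le; have := leq_trans n0 nU.
  by rewrite ltnNge leq_mul2l le orbT.
have [b0 b0B] : exists b0, b0 \in B by apply/card_gt0P; rewrite Bh.
have [u0 u0U] : exists u0, u0 \in U by apply/card_gt0P; apply: leq_trans Ubig.
have BA b : b \in B -> b \notin A.
  by move=> bB; have := adj b u0 bB u0U; rewrite gadj_sym => /offA.
have UA u : u \in U -> u \notin A by move=> uU; have /offA := adj b0 u b0B uU.
have BUA s : {subset s <= B :|: U} -> [disjoint s & A].
  move=> sub; apply/pred0P => x /=; apply/negP => /andP[/sub].
  by rewrite inE => /orP[/BA/negPf->|/UA/negPf->].
have cB := card_avoid G B; have := card_meeting B gG; rewrite Bh => mB.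
have adjG b u : b \in B -> u \in U -> gadj G u b by move=> bB uU; apply/sub1/adj.
have subB : {subset avoid G B <= G} := @avoid_sub _ G B.
have [||[ss fss dss]|[ss [x [x' pen]]]] :=
  ih T col c (avoid G B) A (avoid_graph (X := B) gG) _ kA.
- exact: sub_in2 cG.
- by move: lt; rewrite cB; lia.
- have [sh uss ssG] := fss; pose X := [set y in flatten ss].
  have cX : #|X| = M by rewrite cardsE (card_uniqP uss) (size_forest sh).
  have [||s [sz us sBU sX sE]] := @zigzag _ _ c G B U X [::] gG cG dBU adjG.
  + apply/pred0P => y /=; apply/negP => /andP[]; rewrite inE.
    by move=> /(forest_cover fss odds2) /cover_avoid[_ /negP].
  + rewrite Bh cX addn0; apply: leq_ltn_trans Ubig.
    by rewrite -addnA leq_add2l (leq_trans _ (leq_addr _ _)) // !leqW.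
  left; exists (s :: ss).
    rewrite /odds /= -Bh -sz; apply: forest_cons => //.
    * by apply: disjointWr sX; apply/subsetP => y; rewrite inE.
    * by move=> e /sE[].
    * by split=> // e /ssG /subB.
  by rewrite /= disjoint_cat BUA.
have [[rss ssG] dss [xA x'A xs x's] [xx' cxx'] xa] := pen.
have [sh uss uc] := rss.
pose X := [set y in x :: x' :: flatten ss].
pose Z := c [set x; x'] :: map c (fedges ss) ++ [seq c [set x; a] | a <- enum A].
have szX : #|X| <= M.+2.
  by rewrite cardsE (leq_trans (card_size _)) //= (size_forest sh).
have szZ : size Z <= (M + k).+1.
  rewrite /= size_cat !size_map -cardE kA ltnS leq_add2r.
  by rewrite /M -(size_forest sh) size_fedges.
have [||s [sz us sBU sX sE]] := @zigzag _ _ c G B U X Z gG cG dBU adjG.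
- apply/pred0P => y /=; apply/negP; rewrite !inE => /andP[/or3P[/eqP->|/eqP->|ys] yB].
  + by have /cover_avoid[_] := cover_edge xx'; rewrite yB.
  + by move: xx'; rewrite gadj_sym => /cover_edge/cover_avoid[_]; rewrite yB.
  + by have /cover_avoid[_] := ssG y ys; rewrite yB.
- by rewrite Bh; apply: leq_ltn_trans Ubig; rewrite leq_add ?leq_double // leq_add2l.
have nX y : y \in x :: x' :: flatten ss -> y \notin s.
  by move=> yX; apply/negP => ys; move/pred0P: sX => /(_ y) /=; rewrite ys inE yX.
have newc z : z \in Z -> z \notin map c (pedges s).
  by move=> zZ; apply/negP => /mapP[e /sE[_ /negP eZ] zE]; apply: eZ; rewrite -zE.
right; exists (s :: ss), x, x'; split.
- split.
    rewrite /odds /= -Bh -sz; apply: rainbow_cons => //.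
    + by apply: disjointWr sX; apply/subsetP => y yss; rewrite !inE yss !orbT.
    + rewrite map_inj_in_uniq ?uniq_pedges // => e f /sE[eG _] /sE[fG _]; exact: cG.
    + by move=> e /sE[_]; rewrite inE mem_cat !negb_or => /and3P[].
  move=> y; rewrite /= mem_cat => /orP[ys|/ssG/cover_avoid[]//].
  have s2 : 1 < size s by rewrite sz Bh ltnS double_gt0.
  have [e es ye] := pedges_cover s2 ys; apply/bigcupP; exists e => //.
  by have [] := sE e es.
- by rewrite /= disjoint_cat BUA.
- by split=> //; rewrite /= mem_cat negb_or ?xs ?x's andbT nX // !inE eqxx ?orbT.
- split; first exact: subB.
  rewrite /fedges /= map_cat mem_cat negb_or cxx' andbT; apply: newc.
  exact: mem_head.
move=> a aA; have [xaG ca] := xa a aA; split; first exact: subB.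
rewrite /fedges /= map_cat mem_cat negb_or ca andbT; apply: newc.
rewrite in_cons mem_cat; apply/orP; right; apply/orP; right.
by apply/mapP; exists a; rewrite ?mem_enum.
Qed.

(** * Vertices of low degree and the even path *)

Lemma sum_degrees (T : finType) (G : {set {set T}}) (U : {set T}) : is_graph G ->
  \sum_(u in U) #|meeting G [set u]| <= #|G|.*2.
Proof.
move=> gG; have degE u : #|meeting G [set u]| = \sum_(e in G) (u \in e).
  rewrite -sum1_card big_mkcond [RHS]big_mkcond; apply: eq_bigr => e _.
  rewrite inE; case: (e \in G) => //=; rewrite -setI_eq0.
  by case ue: (u \in e); rewrite (setI_eq0, setIC) ?disjoints1 ?ue // disjoint_sym disjoints1 ue.
rewrite (eq_bigr _ (fun u _ => degE u)) exchange_big /= -muln2 -sum_nat_const.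
apply: leq_sum => e eG; rewrite -(gG e eG) -sum1_card.
rewrite big_mkcond [X in _ <= X]big_mkcond; apply: leq_sum => u _.
by case: (u \in U); case: (u \in e).
Qed.

(** Otherwise all but at most one vertex of [U] have degree above [d], against [sum_degrees]. *)
Lemma two_low_degrees (T : finType) (G : {set {set T}}) (U : {set T}) d : is_graph G ->
  #|G|.*2 + d.+1 < d.+1 * #|U| -> exists u u', [/\ u \in U, u' \in U, u != u',
    #|meeting G [set u]| <= d & #|meeting G [set u']| <= d].
Proof.
move=> gG lt; pose L := [set u in U | #|meeting G [set u]| <= d].
have [/card_gt1P[u [u' [uL u'L uu']]]|L1] := ltnP 1 #|L|.
  by move: uL u'L; rewrite !inE => /andP[? ?] /andP[? ?]; exists u, u'.
exfalso; move: lt; apply/negP; rewrite -leqNgt.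
have : \sum_(u in U :\: L) d.+1 <= #|G|.*2.
  apply: leq_trans (sum_degrees U gG); rewrite [X in _ <= X](big_setID L) /=.
  apply: leq_trans (leq_addl _ _); apply: leq_sum => u; rewrite !inE => /andP[].
  by case: (u \in U) => //=; rewrite -ltnNge.
rewrite sum_nat_const => le; have := cardsID L U.
have : #|U :&: L| <= 1 by apply: leq_trans L1; apply: subset_leq_card; apply: subsetIr.
by move: le; nia.
Qed.

(* The extra edge of [P_(2h+2)] joins two low-degree vertices of the common
   neighbourhood, or is the pendant edge of [ar_odds]. *)
Lemma ar_even hs h : hs != [::] -> all (leq 1) hs -> exists C,
  forall (T : finType) (col : eqType) (c : {set T} -> col) (G : {set {set T}}),
  is_graph G -> {in G &, injective c} ->
  (h + sumn hs) * #|T| + C < #|G| + #|T| ->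
  exists ss, rainbow c (h.*2.+2 :: odds hs) ss.
Proof.
move=> hs0 hs1; have [Ct tb] := odd_turan hs0 hs1.
have s0 : 0 < sumn hs by case: (hs) hs0 hs1 => //= a l _ /andP[a0 _]; rewrite ltn_addr.
have odds2 := odds_ge2 hs1.
have [C0 [D0 ext]] := hub_or_forest (h := h) tb odds2 s0 (leqnn _).
have [C1 ar] := ar_odds h hs0 hs1.
have [q qE] : exists q, h + sumn hs = q.+1.
  by exists (h + sumn hs).-1; rewrite prednK // addn_gt0 s0 orbT.
(* As [#|T| <= D0 * #|U|], this [d] makes [d * #|U|] at least [2 * q.+1 * #|T|], which up to a
   constant exceeds the degree sum of the subgraph [G0] below. *)
rewrite qE; pose M := sumn (odds hs); pose d := 2 * q.+1 * D0.
pose C2 := C0 + C1 + 2 * d + 2.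
pose K0 := 2 * C2 + 2 + d.+1 + (h + M.+1 + M.+1.*2).
pose N0 := (D0 * K0).+1.
exists (C2 + (2 ^ N0).*2 + N0) => T col c G gG cG lt.
have n0 : N0 <= #|T|.
  by apply: (@graph_large _ G); clear -lt; clearbody N0 C2; lia.
(* Passing to a subgraph just above the threshold makes the number of edges linear in [#|T|], so
   that [U] contains vertices of bounded degree. *)
have [|G0 G0G G0c] := @ex_subset _ G (q * #|T| + C2.+1).
  by clear -lt; clearbody N0 C2; lia.
have {}G0c : #|G0| + #|T| = q.+1 * #|T| + C2.+1 by rewrite G0c mulSn addnAC [q * _ + _]addnC.
have gG0 : is_graph G0 by move=> e /(subsetP G0G) /gG.
have cG0 : {in G0 &, injective c} by apply: sub_in2 cG; apply/subsetP.
have [|[ss fss]|[B [U [Bh dBU adj nU]]]] := ext T G0 gG0.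
- by rewrite qE G0c ltn_add2l ltnS /C2 -!addnA leq_addr.
- by exists ss; apply: forest_rainbow fss.
have Ubig : K0 < #|U|.
  rewrite ltnNge; apply/negP => le; have := leq_trans n0 nU.
  by rewrite ltnNge leq_mul2l le orbT.
have [|u [u' [uU u'U uu' du du']]] := @two_low_degrees _ G0 U d gG0.
  have le : q.+1 * #|T| <= q.+1 * (D0 * #|U|) by rewrite leq_mul2l nU orbT.
  have dU : d * #|U| = 2 * (q.+1 * (D0 * #|U|)) by rewrite /d -!mulnA.
  have {}Ubig : 2 * C2 + 2 + d.+1 < #|U| by apply: leq_ltn_trans Ubig; apply: leq_addr.
  rewrite mulSn dU; clear -le Ubig G0c; clearbody d C2.
  move: (q.+1 * #|T|) (q.+1 * (D0 * #|U|)) le G0c => x y le G0c; lia.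
pose z := c [set u; u'].
(* This costs at most [2 * d + 1] edges and keeps every forest in [G'] clear of [u], [u'] and the
   colour [z]. *)
pose G' := [set e in G0 | [&& u \notin e, u' \notin e & c e != z]].
have G'G0 : {subset G' <= G0} by move=> e; rewrite inE => /andP[].
have gG' : is_graph G' by move=> e /G'G0 /gG0.
have cG' : {in G' &, injective c} by apply: sub_in2 cG0.
have G'c : #|G0| <= #|G'| + d + d + 1.
  have c1 : #|[set e in G0 | c e == z]| <= 1.
    apply/card_le1_eqP => e f; rewrite !inE => /andP[eG /eqP ez] /andP[fG /eqP fz].
    by apply: cG0; rewrite // ez fz.
  apply: (@leq_trans #|G' :|: meeting G0 [set u] :|: meeting G0 [set u'] :|:
      [set e in G0 | c e == z]|); last first.
    do 3! [rewrite cardsU (leq_trans (leq_subr _ _)) // leq_add //].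
  apply: subset_leq_card; apply/subsetP => e eG; rewrite !in_setU !inE eG /=.
  rewrite ![[disjoint e & _]]disjoint_sym !disjoints1.
  by case: (u \in e); case: (u' \in e); case: (c e == z).
have [|[ss fss dss]|[ss [x [x' pen]]]] := ar T col c G' B gG' cG' Bh.
- by rewrite qE; clear -G'c G0c; rewrite /C2 in G0c; clear C2; clearbody d; lia.
- have rss := forest_rainbow cG' fss; have [sh uss ssG] := fss.
  have off v : v \in flatten ss -> v != u /\ v != u'.
    move=> /(forest_cover fss odds2) /bigcupP[e]; rewrite inE => /and4P[_ ue u'e _] ve.
    by split; apply: contraTneq ve => ->.
  have fin y y' : y \in U -> y' \in U -> y' != y -> y \notin flatten ss ->
      y' \notin flatten ss -> c [set y'; y] = z ->
      (forall e, e \in G' -> y \notin e) -> (forall b, b \in B -> c [set y; b] != z) ->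
      exists ss, rainbow c (h.*2.+2 :: odds hs) ss.
    move=> yU y'U yy' yss y'ss cy ye cyb.
    have UB v : v \in U -> v \notin B.
      by move=> vU; apply/negP => vB; move/pred0P: dBU => /(_ v) /=; rewrite vU vB.
    have [|b bB||s' rs] :=
      attach gG0 cG0 dBU adj rss dss (UB y yU) (UB y' y'U) yy' yss y'ss.
    + rewrite cy; apply/mapP => -[e /ssG]; rewrite inE => /and4P[_ _ _ cez] E.
      by rewrite -E eqxx in cez.
    + have yb := adj b y bB yU; split=> //; rewrite cy inE negb_or cyb //=.
      apply/mapP => -[e /ssG eG' E]; have := ye e eG'.
      by rewrite -(cG0 _ _ yb (G'G0 _ eG') E) !inE eqxx.
    + by rewrite Bh; apply: leq_ltn_trans Ubig; apply: leq_addl.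
    by exists (s' :: ss); rewrite -Bh.
  have uss' : u \notin flatten ss by apply/negP => /off[]; rewrite eqxx.
  have u'ss : u' \notin flatten ss by apply/negP => /off[_]; rewrite eqxx.
  (* The end that continues into [B] must have no edge of colour [z] to [B]; as at most one edge of
     [G0] has this colour, [u] or [u'] qualifies. *)
  have [/existsP[b /andP[bB /eqP cb]]|/existsPn nb] :=
    boolP [exists b, (b \in B) && (c [set u; b] == z)].
    apply: (fin u' u) => //; first by move=> e; rewrite inE => /and4P[].
    move=> b' b'B; apply/eqP => cb'; have ub := adj b u bB uU.
    have ub' := adj b' u' b'B u'U; have : u \in [set u'; b'].
      by rewrite (cG0 _ _ ub' ub) ?cb' // !inE eqxx.
    rewrite !inE (negPf uu') /= => /eqP ub''.
    by move/pred0P: dBU => /(_ u) /=; rewrite uU ub'' b'B.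
  apply: (fin u u') => //; rewrite 1?eq_sym //; first by rewrite setUC.
    by move=> e; rewrite inE => /and4P[].
  by move=> b bB; have := nb b; rewrite bB.
(* Here the odd paths may use an edge outside [G'], possibly of colour [z], so the even path starts
   with the pendant edge instead. *)
have [[rss ssG] dss [xB x'B xs x's] [xx' cxx'] xa] := pen.
have [||b bB||s' rs] := attach gG0 cG0 dBU adj rss dss xB x'B _ xs x's.
- by rewrite eq_sym; apply: gadj_neq gG' xx'.
- by rewrite setUC.
- have [xb cb] := xa b bB; split; first exact: G'G0.
  rewrite inE negb_or cb andbT; apply/eqP => E.
  have x'x : gadj G' x' x by rewrite gadj_sym.
  have : b \in [set x'; x] by rewrite -(cG' _ _ xb x'x E) !inE eqxx orbT.
  by rewrite !inE => /orP[]/eqP bE; [move: x'B | move: xB]; rewrite -bE bB.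
- by rewrite Bh; apply: leq_ltn_trans Ubig; apply: leq_addl.
by exists (s' :: ss); rewrite -Bh.
Qed.

(** * The bounds *)

Lemma representatives (S T : finType) (c : S -> T) (E : {set S}) :
  exists G : {set S}, [/\ G \subset E, {in G &, injective c} & #|G| = #|c @: E|].
Proof.
pose r t := [pick e in E | c e == t].
pose G := [set e in E | r (c e) == Some e].
have cG : {in G &, injective c}.
  move=> e f; rewrite !inE => /andP[_ /eqP re] /andP[_ /eqP rf] ef.
  by move: re; rewrite ef rf => -[].
have GE : G \subset E by apply/subsetP => e; rewrite inE => /andP[].
exists G; split=> //; rewrite -(card_in_imset cG); congr #|pred_of_set _|.
apply/eqP; rewrite eqEsubset imsetS //=; apply/subsetP => _ /imsetP[e eE ->].
case re: (r (c e)) => [f|]; last first.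
  by move: re; rewrite /r; case: pickP => // /(_ e); rewrite eE eqxx.
have [fE /eqP cf] : f \in E /\ c f == c e.
  by move: re; rewrite /r; case: pickP => // f' /andP[? ?] [<-].
by rewrite -cf; apply: imset_f; rewrite inE fE cf re eqxx.
Qed.

(** * From lists of paths to copies of the disjoint union *)

Lemma edges_completeP n (e : {set complete_graph n}) :
  reflect (#|e| = 2) (e \in edges (complete_graph n)).
Proof.
apply: (iffP imsetP) => [[[x y] xy ->]|/eqP/cards2P[x [y [xy ->]]]].
  by rewrite cards2; move: xy; rewrite inE /= /complete_adj => ->.
by exists (x, y).
Qed.

Lemma uniq_map_inj (S T : eqType) (c : S -> T) l : uniq (map c l) -> {in l &, injective c}.
Proof.
elim: l => //= a l IH /andP[al ul] x y; rewrite !inE.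
case/orP=> [/eqP->|xl] /orP[/eqP->|yl] // cE; last exact: IH.
  by move: al; rewrite cE map_f.
by move: al; rewrite -cE map_f.
Qed.

Lemma nth_flatten_inj (T : eqType) (x0 : T) ss i j a b : uniq (flatten ss) ->
  a < size (nth [::] ss i) -> b < size (nth [::] ss j) ->
  nth x0 (nth [::] ss i) a = nth x0 (nth [::] ss j) b -> i = j /\ a = b.
Proof.
elim: ss i j => [|s ss IH] i j; first by rewrite nth_nil.
rewrite /= cat_uniq => /and3P[us /hasPn dis uss].
have in_rest m d : d < size (nth [::] ss m) -> nth x0 (nth [::] ss m) d \in flatten ss.
  move=> dm; apply/flattenP; exists (nth [::] ss m); last exact: mem_nth.
  by apply: mem_nth; rewrite ltnNge; apply: contraTN dm => ?; rewrite nth_default.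
case: i j => [|i] [|j] /= ai bj E.
- by split=> //; apply/eqP; rewrite -(nth_uniq x0 ai bj us) E.
- by have := dis _ (in_rest _ _ bj); rewrite /= -E mem_nth.
- by have := dis _ (in_rest _ _ ai); rewrite /= E mem_nth.
by have [-> ->] := IH i j uss ai bj E.
Qed.

Lemma nth_pedges (T : finType) (x0 : T) s m : m.+1 < size s ->
  [set nth x0 s m; nth x0 s m.+1] \in pedges s.
Proof.
case: s => // x s; elim: s x m => //= y s IH x [|m] ms; first exact: mem_head.
by rewrite in_cons (IH y m) ?orbT.
Qed.

Lemma union_edgeP (I : finType) (G : I -> sgraph) (e : {set disjoint_union G}) :
  reflect (exists i (x y : G i), adj x y /\
    e = [set (Tagged (fun i => G i : Type) x : disjoint_union G);
             (Tagged (fun i => G i : Type) y : disjoint_union G)])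
  (e \in edges (disjoint_union G)).
Proof.
apply: (iffP imsetP) => [[[[i x] [j y]]]|[i [x [y [xy ->]]]]]; last first.
  exists (Tagged (fun i => G i : Type) x, Tagged (fun i => G i : Type) y) => //.
  by rewrite inE [adj _ _]/(union_adj _ _) /union_adj tagged_asT eqxx.
rewrite inE => /andP[/eqP ij]; simpl in ij.
by case: j / ij y => y; rewrite tagged_asT => xy ->; exists i, x, y.
Qed.

(** Path [i] is laid along the row at the position of [i] in [ks], ignoring surplus vertices at its
    end. The list [ks] leaves the order free, since [ar_even] puts the even path first. *)
Lemma rainbow_has_copy k n (p g : 'I_k -> nat) (T : finType)
    (c : {set complete_graph n} -> T) (ks : seq 'I_k) ss : 0 < n ->
  (forall i, i \in ks) -> (forall i, p i <= g i) -> rainbow c (map g ks) ss ->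
  has_rainbow_copy (disjoint_union (fun i => path_graph (p i))) c.
Proof.
move=> n0 allk pg [sh uss uc]; pose x0 : complete_graph n := Ordinal n0.
pose F := disjoint_union (fun i => path_graph (p i)).
pose row (i : 'I_k) := nth [::] ss (index i ks).
have szr i : p i <= size (row i).
  have ik : index i ks < size ks by rewrite index_mem.
  apply: leq_trans (pg i) _; rewrite -(nth_shape ss) sh (nth_map i) //.
  by rewrite nth_index.
pose f := [ffun u : F => nth x0 (row (tag u)) (tagged u : 'I_(p (tag u)))].
have inj : injective f.
  move=> [i x] [j y]; rewrite !ffunE /= => E.
  have xi : x < size (row i) := leq_trans (ltn_ord x) (szr i).
  have yj : y < size (row j) := leq_trans (ltn_ord y) (szr j).
  have [ij xy] := nth_flatten_inj uss xi yj E.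
  have {}ij : i = j by rewrite -(nth_index i (allk i)) ij nth_index.
  by case: j / ij y E xy {yj} => y _ /val_inj->.
have edgeP (e : {set F}) : e \in edges F -> f @: e \in fedges ss.
  have row_edge i m : m.+1 < p i ->
      [set nth x0 (row i) m; nth x0 (row i) m.+1] \in fedges ss.
    move=> mi; have ms := leq_trans mi (szr i); apply/flattenP.
    exists (pedges (row i)); last exact: nth_pedges.
    apply: map_f; apply: mem_nth; rewrite ltnNge; apply: contraTN ms => ?.
    by rewrite /row nth_default.
  case/union_edgeP=> i [x [y [/orP[]/eqP xy ->]]];
    rewrite imsetU1 imset_set1 !ffunE /= -xy; first by apply: row_edge; rewrite xy.
  by rewrite setUC; apply: row_edge; rewrite xy.
apply/existsP; exists f; apply/andP; split.
  apply/andP; split; first exact/injectiveP.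
  apply/forallP => x; apply/forallP => y; apply/implyP => xy.
  by rewrite /= /complete_adj (inj_eq inj); apply: contraTneq xy => ->; rewrite adj_irrefl.
apply/dinjectiveP => d e dF eF E; apply: (imset_inj inj).
exact: (uniq_map_inj uc) (edgeP d dF) (edgeP e eF) E.
Qed.

(** * The upper bound *)

Lemma leq_sum_halves k (p : 'I_k -> nat) : (forall i, 2 <= p i) ->
  k <= \sum_(i < k) p i %/ 2.
Proof.
move=> p2; rewrite -{1}(card_ord k) -sum1_card; apply: leq_sum => i _.
by rewrite divn2 half_gt0.
Qed.

Lemma anti_ramsey_upper k (p : 'I_k -> nat) : 2 <= k -> (forall i, 2 <= p i) ->
  let eps := if [forall i, odd (p i)] then 1 else 2 in
  exists C, forall n,
    anti_ramsey (complete_graph n) (disjoint_union (fun i => path_graph (p i)))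
      + eps * n <= (\sum_(i < k) p i %/ 2) * n + C.
Proof.
move=> k2 p2 eps.
have halves_gt0 (s : seq 'I_k) : all (leq 1) (map (fun i => (p i)./2) s).
  by rewrite all_map; apply/allP => i _ /=; rewrite half_gt0 p2.
(* Here [G] stands for a choice of one edge from each colour class, so [#|G|] is the number of
   colours. *)
suff [C H] : exists C, forall n (c : {set complete_graph n} -> {set complete_graph n})
    (G : {set {set complete_graph n}}),
    0 < n -> is_graph G -> {in G &, injective c} ->
    (\sum_(i < k) p i %/ 2) * n + C < #|G| + eps * n ->
    has_rainbow_copy (disjoint_union (fun i => path_graph (p i))) c.
  exists C => n; set F := disjoint_union _.
  have s2 : eps <= \sum_(i < k) p i %/ 2.
    apply: leq_trans (leq_sum_halves p2).
    by rewrite /eps; case: ifP; rewrite // ltnW.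
  have le : eps * n <= (\sum_(i < k) p i %/ 2) * n by rewrite leq_mul2r s2 orbT.
  suff : anti_ramsey (complete_graph n) F <= (\sum_(i < k) p i %/ 2) * n + C - eps * n.
    by move: le; lia.
  apply/bigmax_leqP => c; apply: contraR; rewrite -ltnNge ltn_subLR; last first.
    by rewrite (leq_trans le) // leq_addr.
  have [G [GE cG]] := representatives c (edges (complete_graph n)).
  rewrite /num_colors => <-; rewrite [eps * n + _]addnC => lt.
  have gG : is_graph G by move=> e /(subsetP GE)/edges_completeP.
  suff n0 : 0 < n by apply: (H n c G n0 gG cG lt).
  rewrite lt0n; apply: contraTneq lt => n0; rewrite -leqNgt.
  suff -> : #|G| = 0 by rewrite n0 !muln0.
  apply/eqP; rewrite cards_eq0 -subset0; apply/subsetP => e /gG e2.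
  have en : #|e| <= n by rewrite -[X in _ <= X]card_ord max_card.
  by exfalso; move: en; rewrite e2 n0.
rewrite {}/eps; case: ifP => [/forallP allodd|/negbT/forallPn[j evj]].
  pose hs := map (fun i => (p i)./2) (enum 'I_k).
  have hs0 : hs != [::] by rewrite -size_eq0 size_map size_enum_ord -lt0n ltnW.
  have sE : sumn hs = \sum_(i < k) p i %/ 2.
    by rewrite sumnE big_map big_enum; apply: eq_bigr => i _; rewrite divn2.
  (* For empty [A] both outcomes of [ar_bound] contain a rainbow forest of the required shape. *)
  have [C ar] := ar_odds 0 hs0 (halves_gt0 _).
  exists C => n c G n0 gG cG lt.
  have [|[ss fss _]|[ss [x [x' [[rss _] _ _ _ _]]]]] :=
    ar _ _ c G set0 gG cG (cards0 _).
  - by rewrite sE card_ord -[X in _ < _ + X]mul1n.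
  - apply: (@rainbow_has_copy _ _ p (fun i => (p i)./2.*2.+1) _ _ (enum 'I_k) ss n0).
    + by move=> i; rewrite mem_enum.
    + by move=> i; rewrite -{1}(odd_double_half (p i)) allodd.
    + by have := forest_rainbow cG fss; rewrite /odds /hs -map_comp.
  - apply: (@rainbow_has_copy _ _ p (fun i => (p i)./2.*2.+1) _ _ (enum 'I_k) ss n0).
    + by move=> i; rewrite mem_enum.
    + by move=> i; rewrite -{1}(odd_double_half (p i)) allodd.
    + by move: rss; rewrite /odds /hs -map_comp.
pose ks := filter (predC1 j) (enum 'I_k).
pose hs := map (fun i => (p i)./2) ks.
have hs0 : hs != [::].
  have /card_gt0P[i ij] : 0 < #|predC1 j| by rewrite cardC1 card_ord; case: (k) k2 => [|[]].
  have : i \in ks by rewrite mem_filter mem_enum andbT; exact: ij.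
  by rewrite /hs; case: (ks).
(* The hub of the even path has one vertex less than half of [p j]; with the unit already gained in
   [ar_even] this gives [eps = 2]. *)
pose h := (p j)./2.-1.
have hE : h.+1 = (p j)./2 by rewrite /h prednK // half_gt0.
have pE : h.*2.+2 = p j by rewrite -[RHS]odd_double_half (negPf evj) -hE.
have sE : h + sumn hs + 1 = \sum_(i < k) p i %/ 2.
  rewrite (bigD1 j) //= divn2 -hE addnAC addn1; congr (_ + _).
  rewrite sumnE big_map big_filter big_enum_cond /=.
  by apply: eq_bigr => i _; rewrite divn2.
have [C ar] := ar_even h hs0 (halves_gt0 _).
exists C => n c G n0 gG cG lt.
have [|ss rss] := ar _ _ c G gG cG.
  by move: lt; rewrite -sE card_ord mulnDl mul1n mul2n -addnn addnA addnAC ltn_add2r.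
pose g i := if i == j then h.*2.+2 else (p i)./2.*2.+1.
apply: (@rainbow_has_copy _ _ p g _ _ (j :: ks) ss n0).
- by move=> i; rewrite in_cons mem_filter mem_enum /= andbT orbN.
- move=> i; rewrite /g; case: eqP => [->|_]; first by rewrite pE.
  by rewrite -{1}(odd_double_half (p i)) -add1n leq_add2r leq_b1.
rewrite /= {1}/g eqxx (_ : map g ks = odds hs) //.
rewrite /odds /hs -map_comp; apply/eq_in_map => i; rewrite mem_filter /= /g.
by case: eqP.
Qed.

(** * The lower bound: vertex covers of paths *)

Lemma vertex_cover_count (a : nat -> bool) m q :
  (forall j, m <= j -> j.+1 < q -> a j || a j.+1) ->
  (q - m)./2 <= \sum_(m <= j < q) a j.
Proof.
have [d] := ubnP (q - m); elim: d m => // d IH m; rewrite ltnS => le H.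
have [lt|?] := ltnP m.+1 q; last first.
  by apply: leq_trans (leq0n _); rewrite leqn0; apply/eqP; lia.
rewrite big_ltn ?(ltnW lt) // big_ltn // addnA.
have -> : (q - m)./2 = 1 + (q - m.+2)./2 by lia.
apply: leq_add; first by have := H m (leqnn _) lt; case: (a m); case: (a m.+1).
by apply: IH => [|j mj]; [lia | apply: H; lia].
Qed.

(** The uncovered edge, if any, splits the path into two fully covered parts, on [i.+1] and
    [q - i.+1] vertices. *)
Lemma near_vertex_cover_count (a : nat -> bool) q :
  (forall i j, i.+1 < q -> j.+1 < q -> ~~ (a i || a i.+1) -> ~~ (a j || a j.+1) -> i = j) ->
  q.-1./2 <= \sum_(j < q) a j.
Proof.
move=> H; rewrite -(big_mkord xpredT (fun j => a j : nat)).
have [/existsP[i /andP[iq ai]]|/existsPn none] :=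
  boolP [exists i : 'I_q, (i.+1 < q) && ~~ (a i || a i.+1)].
  rewrite (@big_cat_nat _ _ _ i.+1) //=.
  have L1 : (i.+1 - 0)./2 <= \sum_(0 <= j < i.+1) a j.
    apply: vertex_cover_count => j _ ji; apply: contraT => nj.
    by move: (ji); rewrite (H j i (ltn_trans ji iq) iq nj ai) ltnn.
  have L2 : (q - i.+1)./2 <= \sum_(i.+1 <= j < q) a j.
    apply: vertex_cover_count => j ij jq; apply: contraT => nj.
    by move: (ij); rewrite (H j i jq iq nj ai) ltnn.
  by apply: leq_trans (leq_add L1 L2); rewrite subn0; move: (ltn_ord i); lia.
apply: leq_trans (@vertex_cover_count a 0 q _); first by rewrite subn0; lia.
move=> j _ jq; have := none (Ordinal (ltnW jq)).
by rewrite /= jq /= negbK.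
Qed.

(** All edges off [A] share the colour [set0], so the preimage of [A] covers all edges of a rainbow
    copy but at most one. An uncovered edge saves a vertex only on a path of even order, and then
    only one, so [A] is too small. *)
Lemma complete_free k (p : 'I_k -> nat) n (A : {set 'I_n}) :
  (forall i, 2 <= p i) ->
  #|A| + (if [forall i, odd (p i)] then 1 else 2) = \sum_(i < k) p i %/ 2 ->
  ~~ has_rainbow_copy (H := complete_graph n) (disjoint_union (fun i => path_graph (p i)))
    (fun e : {set 'I_n} => if [disjoint e & A] then set0 else e).
Proof.
move=> p2 cA; apply/negP => /existsP[f /andP[/andP[/injectiveP inj _] /dinjectiveP rb]].
pose F := disjoint_union (fun i => path_graph (p i)).
pose v i (x : 'I_(p i)) : F := Tagged (fun i => path_graph (p i) : Type) x.
pose a i j := [exists x : 'I_(p i), (x == j :> nat) && (f (v i x) \in A)].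
have aE i (x : 'I_(p i)) : a i x = (f (v i x) \in A).
  apply/existsP/idP => [[y /andP[/eqP/val_inj-> //]]|xA].
  by exists x; rewrite eqxx.
have total : \sum_(i < k) \sum_(j < p i) a i j <= #|A|.
  apply: (@leq_trans #|[set u : F | f u \in A]|).
    rewrite -sum1_card [X in _ <= X]big_mkcond /=.
    under eq_bigr do under eq_bigr do rewrite aE.
    rewrite sig_big_dep /=; apply: eq_leq; apply: eq_bigr => -[i x] _.
    by rewrite inE; case: (_ \in A).
  rewrite -(card_imset _ inj); apply: subset_leq_card.
  by apply/subsetP => _ /imsetP[u uA ->]; rewrite inE in uA.
pose exc i j := (j.+1 < p i) && ~~ (a i j || a i j.+1).
(* Two uncovered edges have the same colour, hence coincide, and an edge determines its path and
   position. *)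
have excP i j i' j' : exc i j -> exc i' j' -> i = i' /\ j = j'.
  pose pr i0 j0 (u : F * F) := [/\ j0.+1 < p i0,
     exists x y, [/\ u = (v i0 x, v i0 y), x = j0 :> nat & y = j0.+1 :> nat] &
     [set u.1; u.2] \in edges F /\ [disjoint f @: [set u.1; u.2] & A]].
  have mk i0 j0 : exc i0 j0 -> exists u, pr i0 j0 u.
    move=> /andP[jp]; rewrite negb_or => /andP[n1 n2].
    pose x : 'I_(p i0) := Ordinal (ltnW jp); pose y : 'I_(p i0) := Ordinal jp.
    exists (v i0 x, v i0 y); split=> //; first by exists x, y.
    split; first by apply/union_edgeP; exists i0, x, y; rewrite /= /path_adj eqxx.
    rewrite imsetU1 imset_set1; apply/pred0P => z; rewrite /= !inE.
    apply/negP => /andP[/orP[]/eqP-> fA]; [move: n1|move: n2].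
      by rewrite -[j0]/(x : nat) aE fA.
    by rewrite -[j0.+1]/(y : nat) aE fA.
  move=> /mk[u [_ [x [y [uE xj yj]]] [ue ud]]] /mk[w [_ [x' [y' [wE xj' yj']]] [we wd]]].
  have E : [set u.1; u.2] = [set w.1; w.2] by apply: rb; rewrite // ud wd.
  have : v i x \in [set w.1; w.2] by rewrite -E uE !inE eqxx.
  have : v i y \in [set w.1; w.2] by rewrite -E uE !inE eqxx orbT.
  have vE i1 i2 (z1 : 'I_(p i1)) (z2 : 'I_(p i2)) : v i1 z1 = v i2 z2 ->
      i1 = i2 /\ z1 = z2 :> nat.
    move=> eq_v; have it : i1 = i2 by have := congr1 tag eq_v.
    by case: i2 / it z2 eq_v => z2 /eqP; rewrite eq_Tagged => /eqP /= ->.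
  rewrite wE !inE => /orP[]/eqP/vE[ii yz] /orP[]/eqP/vE[_ xz]; split=> //;
    by clear -xj yj xj' yj' yz xz; lia.
(* The vertex saved on path [i]: for odd [p i] there is none, as [(p i).-1./2] equals [(p i)./2]. *)
pose E i := [exists j : 'I_(p i), exc i j] && ~~ odd (p i).
have each i : (p i)./2 <= \sum_(j < p i) a i j + E i.
  have near : (p i).-1./2 <= \sum_(j < p i) a i j.
    apply: near_vertex_cover_count => j j' jp j'p ej ej'.
    by have [] := excP i j i j'; rewrite /exc ?jp ?j'p ?ej ?ej'.
  rewrite /E; case: existsP => [_|none] /=.
    apply: leq_trans (leq_add near (leqnn _)).
    by move: (p i) => q; clear; case: (boolP (odd q)) => oq /=; lia.
  rewrite addn0 -(big_mkord xpredT (fun j => a i j : nat)) -[p i in X in X <= _]subn0.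
  apply: vertex_cover_count => j _ jp; apply: contraT => nj; case: none.
  by exists (Ordinal (ltnW jp)); rewrite /exc /= jp.
have sumE : \sum_(i < k) E i < (if [forall i, odd (p i)] then 1 else 2).
  case: ifP => [/forallP allodd|_].
    by rewrite big1 // => i _; rewrite /E allodd andbF.
  rewrite ltnS.
  have -> : \sum_(i < k) E i = #|[pred i | E i]|.
    by rewrite -sum1_card [RHS]big_mkcond; apply: eq_bigr => i _; rewrite inE; case: (E i).
  apply/card_le1_eqP => i i'; rewrite !inE => /andP[/existsP[j ej] _] /andP[/existsP[j' ej'] _].
  by have [] := excP _ _ _ _ ej ej'.
have : \sum_(i < k) p i %/ 2 <= \sum_(i < k) \sum_(j < p i) a i j + \sum_(i < k) E i.
  by rewrite -big_split; apply: leq_sum => i _; rewrite divn2.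
move=> le; have := leq_trans le (leq_add total (leqnn _)).
by rewrite -cA leq_add2l leqNgt sumE.
Qed.

(** Counting only the [m * (n - m)] edges between [A] and its complement is enough, as the loss
    [m * m] is constant. *)
Lemma anti_ramsey_lower k (p : 'I_k -> nat) m n : (forall i, 2 <= p i) ->
  m + (if [forall i, odd (p i)] then 1 else 2) = \sum_(i < k) p i %/ 2 ->
  m * n <= anti_ramsey (complete_graph n) (disjoint_union (fun i => path_graph (p i)))
    + m * m.
Proof.
move=> p2 mE; have [nm|mn] := leqP n m.
  by rewrite (leq_trans _ (leq_addl _ _)) // leq_mul2l nm orbT.
have [|A _ cA] := @ex_subset _ [set: 'I_n] m; first by rewrite cardsT card_ord ltnW.
have free := @complete_free k p n A p2; rewrite cA in free.
have := @anti_ramsey_max (complete_graph n) _ _ _ (free mE).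
set c := fun e => _; move=> le; apply: leq_trans (leq_add le (leqnn _)).
pose pair (u : 'I_n * 'I_n) : {set 'I_n} := [set u.1; u.2].
have : #|pair @: setX A (~: A)| = m * (n - m).
  rewrite card_in_imset; first by rewrite cardsX cA (cardsCs (~: A)) setCK cA card_ord.
  move=> [x y] [x' y']; rewrite !inE /= => /andP[xA yA] /andP[x'A y'A] /setP E.
  have := E x; rewrite !inE eqxx /= => /esym/orP[/eqP xx|/eqP xy]; last first.
    by rewrite -xy xA in y'A.
  have := E y; rewrite !inE eqxx orbT /= => /esym/orP[/eqP yx|/eqP->]; last by rewrite xx.
  by rewrite yx x'A in yA.
move=> cP; have : #|pair @: setX A (~: A)| <= num_colors (H := complete_graph n) c.
  apply: subset_leq_card; apply/subsetP => e /imsetP[[x y]].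
  rewrite inE /= => /andP[xA]; rewrite inE => yA ->; apply/imsetP.
  exists [set x; y]; last first.
    rewrite /c ifN //; apply/pred0Pn; exists x => /=.
    by rewrite !inE eqxx xA.
  apply/edges_completeP; rewrite cards2; case: eqP => // xy.
  by rewrite -xy xA in yA.
rewrite cP mulnBr; lia.
Qed.

Import Order.TTheory GRing.Theory Num.Theory.
Local Open Scope ring_scope.

Theorem theorem9 (k : nat) (p : 'I_k -> nat)
    (hk : (2 <= k)%N) (hp : forall i, (2 <= p i)%N) :
  exists C : nat, forall n : nat,
    let F := disjoint_union (fun i => path_graph (p i)) in
    let eps := if [forall i, odd (p i)] then 1%N else 2%N in
    `| (anti_ramsey (complete_graph n) F)%:Z
       - ((\sum_(i < k) (p i %/ 2)%N)%N%:Z - eps%:Z) * n%:Z | <= C%:Z.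
Proof.
have [C upper] := anti_ramsey_upper hk hp.
have [m mE] : exists m, (m + (if [forall i, odd (p i)] then 1 else 2))%N =
    (\sum_(i < k) p i %/ 2)%N.
  (* The subtraction is exact: each path contributes at least one to the sum, and [2 <= k]. *)
  exists (\sum_(i < k) p i %/ 2 - (if [forall i, odd (p i)] then 1 else 2))%N.
  rewrite subnK // (leq_trans _ (leq_sum_halves hp)) //.
  by case: ifP => // _; apply: ltnW.
exists (C + m * m)%N => n; cbv zeta.
move: (upper n) (anti_ramsey_lower n hp mE); rewrite -mE mulnDl.
move: (anti_ramsey _ _) (if _ then _ else _) => a eps le ge.
have -> : (m + eps)%N%:Z - eps%:Z = m%:Z by rewrite PoszD addrK.
by clear -le ge; lia.
Qed.
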